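(* Let $T>0$ and let $H:\mathbb{R}^n\times\mathbb{R}^n\to\mathbb{R}$ satisfy: $p\mapsto H(x,p)$ is convex for every $x\in\mathbb{R}^n$, and there is a constant $M\geqslant 0$ such that $|H(x,p)-H(x,q)|\leqslant M(1+|x|)|p-q|$ for all $x,p,q\in\mathbb{R}^n$ and $|H(x,p)-H(y,p)|\leqslant M(1+|p|)|x-y|$ for all $x,y,p\in\mathbb{R}^n$. Then an initial function $g_0\in C(\mathbb{R}^n,\mathbb{R})$ is reconstructible in time $T$ if and only if there exists a backward viscosity solution $v$ of $\nabla_t u+H(x,\nabla_x u)=0$ defined on $[0,T]\times\mathbb{R}^n$ such that $g_0(\cdot)=v(0,\cdot)$. Furthermore, if $v$ is such a backward viscosity solution with $v(0,\cdot)=g_0(\cdot)$, $u:[0,T]\times\mathbb{R}^n\to\mathbb{R}$ is a forward viscosity solution satisfying $u(0,\cdot)=g_0(\cdot)$, and $w:[0,T]\times\mathbb{R}^n\to\mathbb{R}$ is a backward viscosity solution satisfying $w(T,\cdot)=u(T,\cdot)$, then $u\geqslant w\geqslant v$.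
   Context: Consider the equation $\nabla_t u+H(x,\nabla_x u)=0$ in $(0,T)\times\mathbb{R}^n$. For a continuous $u$ and $(t,x)\in(0,T)\times\mathbb{R}^n$, $\partial_+u(t,x)$ (resp. $\partial_-u(t,x)$) is the set of $\nabla\varphi(t,x)$ over all $\varphi\in C^1((0,T)\times\mathbb{R}^n)$ such that $u-\varphi$ has a local maximum (resp. local minimum) at $(t,x)$. A continuous $u:[0,T]\times\mathbb{R}^n\to\mathbb{R}$ is a forward viscosity solution if for every $(t,x)\in(0,T)\times\mathbb{R}^n$: $u_t+H(x,u_x)\leqslant0$ for all $(u_t,u_x)\in\partial_+u(t,x)$ and $u_t+H(x,u_x)\geqslant0$ for all $(u_t,u_x)\in\partial_-u(t,x)$. A continuous $w$ is a backward viscosity solution if for every $(t,x)\in(0,T)\times\mathbb{R}^n$: $w_t+H(x,w_x)\geqslant0$ for all $(w_t,w_x)\in\partial_+w(t,x)$ and $w_t+H(x,w_x)\leqslant0$ for all $(w_t,w_x)\in\partial_-w(t,x)$. An initial function $g_0\in C(\mathbb{R}^n,\mathbb{R})$ is reconstructible in time $T$ if $g_0(\cdot)=w(0,\cdot)$, where $w$ is the unique backward viscosity solution on $[0,T]\times\mathbb{R}^n$ with $w(T,\cdot)=u(T,\cdot)$ and $u$ is the unique forward viscosity solution on $[0,T]\times\mathbb{R}^n$ with $u(0,\cdot)=g_0(\cdot)$. *)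

(* Defs.v *)
From HB Require Import structures.
From mathcomp Require Import all_boot all_order all_algebra.
From mathcomp Require Import all_classical all_reals all_analysis.
Set Implicit Arguments. Unset Strict Implicit. Unset Printing Implicit Defensive.
Import Order.TTheory GRing.Theory Num.Theory.
Import numFieldNormedType.Exports.
Local Open Scope classical_set_scope.
Local Open Scope ring_scope.

Section HJ.
Variables (R : realType) (n : nat).

Definition vec := 'rV[R]_n.
Definition spt := (R * vec)%type.

Definition enorm (x : vec) : R := Num.sqrt (\sum_(i < n) x ord0 i ^+ 2).
Definition dotv (p x : vec) : R := \sum_(i < n) p ord0 i * x ord0 i.

Definition strip_open (T : R) : set spt := [set z | 0 < z.1 < T].
Definition strip_closed (T : R) : set spt := [set z | 0 <= z.1 <= T].

(* phi is C^1 on the open set O: differentiable at every point of O, and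
   the differential depends continuously on the point (tested on every
   direction h, which is equivalent in finite dimension). *)
Definition C1_on (O : set spt) (phi : spt -> R) : Prop :=
  forall z, O z -> differentiable phi z /\
    forall h : spt, {for z, continuous (fun y => ('d phi y : spt -> R) h)}.

Definition has_grad (phi : spt -> R) (z : spt) (a : R) (p : vec) : Prop :=
  forall h : spt, ('d phi z : spt -> R) h = a * h.1 + dotv p h.2.

Definition superdiff (T : R) (u : spt -> R) (z : spt) (a : R) (p : vec) : Prop :=
  exists phi : spt -> R, C1_on (strip_open T) phi /\
    (\forall y \near z, u y - phi y <= u z - phi z) /\ has_grad phi z a p.
Definition subdiff (T : R) (u : spt -> R) (z : spt) (a : R) (p : vec) : Prop :=
  exists phi : spt -> R, C1_on (strip_open T) phi /\
    (\forall y \near z, u z - phi z <= u y - phi y) /\ has_grad phi z a p.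

Definition forward_sol (H : vec -> vec -> R) (T : R) (u : spt -> R) : Prop :=
  {within strip_closed T, continuous u} /\
  forall z, strip_open T z ->
    (forall a p, superdiff T u z a p -> a + H z.2 p <= 0) /\
    (forall a p, subdiff T u z a p -> a + H z.2 p >= 0).

Definition backward_sol (H : vec -> vec -> R) (T : R) (w : spt -> R) : Prop :=
  {within strip_closed T, continuous w} /\
  forall z, strip_open T z ->
    (forall a p, superdiff T w z a p -> a + H z.2 p >= 0) /\
    (forall a p, subdiff T w z a p -> a + H z.2 p <= 0).

Definition unique_sol (T : R) (P : (spt -> R) -> Prop) (f : spt -> R) : Prop :=
  P f /\ forall f', P f' -> forall z, strip_closed T z -> f' z = f z.

Definition reconstructible (H : vec -> vec -> R) (T : R) (g0 : vec -> R) : Prop :=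
  exists u w : spt -> R,
    unique_sol T (fun u => forward_sol H T u /\ forall x, u (0, x) = g0 x) u /\
    unique_sol T (fun w => backward_sol H T w /\ forall x, w (T, x) = u (T, x)) w /\
    forall x, w (0, x) = g0 x.

End HJ.

(* Main.v *)
Require Import Defs.
From HB Require Import structures.
From mathcomp Require Import all_boot all_order all_algebra.
From mathcomp Require Import all_classical all_reals all_analysis.
From mathcomp Require Import ring lra.
Import Order.TTheory GRing.Theory Num.Theory.
Import numFieldNormedType.Exports.
Local Open Scope classical_set_scope.
Local Open Scope ring_scope.

(** Convexity of [H] in [p] makes a continuous function satisfy [a + H(x,p) <= 0]
    on its superdifferentials if and only if it does so on its subdifferentials
    (Barron-Jensen).  Hence a backward solution [v] is a forward subsolution, and
    [v <= u] by comparison.  For the same reason [u] is, after reversing time, a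
    supersolution of the equation with Hamiltonian [-H], of which the time
    reversals of [v] and [w] are solutions.  As [v(T) <= u(T) = w(T)], comparison
    for [-H] gives [v <= w <= u], and at time 0 both outer terms are [g0].
    Comparison and existence only use the two Lipschitz bounds: the speed of
    propagation [M (1 + |x|)] is locally bounded, so everything takes place on
    shrinking regions that need no lateral boundary condition. *)

(** * Space-time as a Euclidean space *)

Section SpaceTime.
Set Implicit Arguments.
Unset Strict Implicit.
Variables (R : realType) (n : nat).
Local Notation E := (spt R n).
Implicit Types (z w h y : E) (p q x : vec R n).

(** Two obstacles shape the details. Perron's supremum is only known to be semicontinuous until it
    has been compared with its own lower envelope, so comparison is proved for semicontinuous
    functions; a supersolution [v] enters it as the subsolution [- v] of [negH H], which leaves a
    single one-sided theory. Moreover the tests of the statement are C^1 on the open strip only, and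
    Perron's argument feeds perturbations of them back to the members of its class, so these members
    must satisfy the inequality for every locally C^1 test. Doubling of variables, in contrast,
    produces tests that are C^1 on all of space-time. Hence comparison assumes the inequality for
    global tests ([gsubsol]) and existence delivers it for local ones ([lsubsol]). *)

Definition sdot z h : R := z.1 * h.1 + dotv z.2 h.2.
(** The norm of the product space is a maximum, hence not differentiable. Balls and penalties in
    space-time are measured by this smooth square instead, so their radii are squared radii. *)
Definition nsq z : R := sdot z z.

Lemma dotvC p q : dotv p q = dotv q p.
Proof. by apply: eq_bigr => i _; rewrite mulrC. Qed.

Lemma dotvDl p q x : dotv (p + q) x = dotv p x + dotv q x.
Proof. by rewrite -big_split; apply: eq_bigr => i _; rewrite mxE mulrDl. Qed.

Lemma dotvDr p q x : dotv x (p + q) = dotv x p + dotv x q.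
Proof. by rewrite !(dotvC x) dotvDl. Qed.

Lemma dotvZl (c : R) p x : dotv (c *: p) x = c * dotv p x.
Proof. by rewrite /dotv mulr_sumr; apply: eq_bigr => i _; rewrite mxE mulrA. Qed.

Lemma dotvZr (c : R) p x : dotv x (c *: p) = c * dotv x p.
Proof. by rewrite !(dotvC x) dotvZl. Qed.

Lemma dotvNl p x : dotv (- p) x = - dotv p x.
Proof. by rewrite -scaleN1r dotvZl mulN1r. Qed.

Lemma dotvNr p x : dotv x (- p) = - dotv x p.
Proof. by rewrite !(dotvC x) dotvNl. Qed.

Lemma dotv_ge0 p : 0 <= dotv p p.
Proof. by apply: sumr_ge0 => i _; exact: sqr_ge0. Qed.

Lemma enormE p : enorm p = Num.sqrt (dotv p p).
Proof. by []. Qed.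

Lemma enorm_sq p : enorm p ^+ 2 = dotv p p.
Proof. by rewrite enormE sqr_sqrtr ?dotv_ge0. Qed.

Lemma enorm_ge0 p : 0 <= enorm p.
Proof. exact: sqrtr_ge0. Qed.

Lemma enormZ (c : R) p : enorm (c *: p) = `|c| * enorm p.
Proof.
by rewrite !enormE dotvZl dotvZr mulrA -expr2 sqrtrM ?sqr_ge0// sqrtr_sqr.
Qed.

Lemma enormN p : enorm (- p) = enorm p.
Proof. by rewrite -scaleN1r enormZ normrN1 mul1r. Qed.

Lemma sdotC z h : sdot z h = sdot h z.
Proof. by rewrite /sdot mulrC dotvC. Qed.

Lemma sdotDl z w h : sdot (z + w) h = sdot z h + sdot w h.
Proof. by rewrite /sdot dotvDl /=; ring. Qed.

Lemma sdotDr z w h : sdot h (z + w) = sdot h z + sdot h w.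
Proof. by rewrite !(sdotC h) sdotDl. Qed.

Lemma sdotZl (c : R) z h : sdot (c *: z) h = c * sdot z h.
Proof. by rewrite /sdot dotvZl /= /GRing.scale /=; ring. Qed.

Lemma sdotZr (c : R) z h : sdot h (c *: z) = c * sdot h z.
Proof. by rewrite !(sdotC h) sdotZl. Qed.

Lemma sdotNl z h : sdot (- z) h = - sdot z h.
Proof. by rewrite /sdot dotvNl /=; ring. Qed.

Lemma sdotNr z h : sdot h (- z) = - sdot h z.
Proof. by rewrite !(sdotC h) sdotNl. Qed.

Definition sdotE := (sdotDl, sdotDr, sdotZl, sdotZr, sdotNl, sdotNr).

Lemma nsqE z : nsq z = z.1 ^+ 2 + enorm z.2 ^+ 2.
Proof. by rewrite enorm_sq /nsq /sdot expr2. Qed.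

Lemma nsq_ge0 z : 0 <= nsq z.
Proof. by rewrite nsqE addr_ge0 ?sqr_ge0. Qed.

Lemma nsq_fst z : z.1 ^+ 2 <= nsq z.
Proof. by rewrite nsqE lerDl sqr_ge0. Qed.

Lemma nsq_snd z : enorm z.2 ^+ 2 <= nsq z.
Proof. by rewrite nsqE lerDr sqr_ge0. Qed.

Lemma nsqN z : nsq (- z) = nsq z.
Proof. by rewrite /nsq !sdotE opprK. Qed.

Lemma nsqB z w : nsq (z - w) = nsq (w - z).
Proof. by rewrite -nsqN opprB. Qed.

Lemma nsq0 : nsq 0 = 0.
Proof. by rewrite -(scale0r 0) /nsq sdotZl mul0r. Qed.

Lemma nsqZ (c : R) z : nsq (c *: z) = c ^+ 2 * nsq z.
Proof. by rewrite /nsq !sdotE mulrA expr2. Qed.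

Lemma nsqD z w : nsq (z + w) <= 2 * nsq z + 2 * nsq w.
Proof.
have := nsq_ge0 (z - w); rewrite /nsq !sdotE (sdotC w z); lra.
Qed.

Lemma nsqDZ (c : R) z h :
  nsq (z + c *: h) = nsq z + c * (2 * sdot z h) + c ^+ 2 * nsq h.
Proof. by rewrite /nsq !sdotE (sdotC h z); ring. Qed.

Lemma nsq_tri z w h : nsq (z - w) <= 2 * nsq (z - h) + 2 * nsq (h - w).
Proof. by have := nsqD (z - h) (h - w); rewrite subrKA. Qed.

Lemma coord_enorm p i : `|p ord0 i| <= enorm p.
Proof.
rewrite -[leLHS]sqrtr_sqr; apply: ler_wsqrtr.
by rewrite /dotv (bigD1 i)//= lerDl; apply: sumr_ge0 => j _; exact: sqr_ge0.
Qed.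

Lemma norm_le_enorm p : `|p| <= enorm p.
Proof.
rewrite [leLHS]/Num.norm /= mx_normrE; apply/bigmax_leP; split.
  exact: enorm_ge0.
by move=> [i j] _ /=; rewrite (ord1 i); exact: coord_enorm.
Qed.

Lemma norm_sq_le_nsq z : `|z| ^+ 2 <= nsq z.
Proof.
rewrite prod_normE; have [h|h] := leP `|z.1| `|z.2|.
- by apply: le_trans (nsq_snd z); rewrite lerXn2r ?nnegrE ?enorm_ge0 ?norm_le_enorm.
- by rewrite real_normK ?num_real// nsq_fst.
Qed.

Lemma continuous_dotv : continuous (fun x => dotv x x).
Proof.
have -> : (fun x => dotv x x) = \sum_(i < n) (fun x : vec R n => x ord0 i * x ord0 i).
  by apply/funext => x; rewrite fct_sumE.
elim/big_ind : _ => [x|f g cf cg x|i _ x]; first exact: (@cst_continuous _ _ (0 : R)).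
- exact: (cvgD (cf x) (cg x)).
- have c := @coord_continuous R 1 n ord0 i x; exact: (cvgM c c).
Qed.

Lemma continuous_enorm : continuous (@enorm R n).
Proof.
move=> x; apply: (@continuous_comp _ _ _ (fun x => dotv x x)).
  exact: continuous_dotv.
exact: sqrt_continuous.
Qed.

Lemma continuous_nsq : continuous nsq.
Proof.
move=> z; apply: cvgD; first by apply: cvgM; exact: cvg_fst.
apply: (@continuous_comp _ _ _ snd (fun x => dotv x x)).
  exact: cvg_snd.
exact: continuous_dotv.
Qed.

Lemma near_nsq z (P : E -> Prop) :
  (\forall y \near z, P y) <->
  exists2 r : R, 0 < r & forall y, nsq (y - z) < r -> P y.
Proof.
split=> [/nbhs_ballP[e /= e0 Pe]|[r r0 Pr]].
  exists (e ^+ 2); first by rewrite exprn_gt0.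
  move=> y yz; apply: Pe; rewrite -ball_normE /ball_ /= distrC.
  rewrite -(@ltr_pXn2r _ 2) ?nnegrE ?(ltW e0)//.
  exact: le_lt_trans (norm_sq_le_nsq _) yz.
have H : \forall y \near (0 : E), nsq y < r.
  by apply: (cvgr_lt (nsq 0) (@continuous_nsq 0)); rewrite nsq0.
apply/nbhs_ballP; move/nbhs_ballP: H => [e /= e0 He].
exists e => //= y yz; apply: Pr; apply: He.
by move: yz; rewrite -!ball_normE /ball_ /= sub0r normrN distrC.
Qed.

End SpaceTime.

(** * Semicontinuity and compactness *)

Section Semicontinuity.
Set Implicit Arguments.
Unset Strict Implicit.
Variables (R : realType).

(** Relative to [A]: values outside the region under study never matter. *)
Definition usc (X : topologicalType) (A : set X) (u : X -> R) : Prop :=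
  forall z, A z -> forall c, u z < c -> \forall y \near z, A y -> u y < c.

Lemma uscS (X : topologicalType) (A B : set X) u :
  A `<=` B -> usc B u -> usc A u.
Proof.
move=> AB uB z /AB Bz c uc; apply: filterS (uB z Bz c uc) => y + /AB; exact.
Qed.

Lemma uscD (X : topologicalType) (A : set X) u v :
  usc A u -> usc A v -> usc A (fun z => u z + v z).
Proof.
move=> uA vA z Az c uvc; pose d := (c - (u z + v z)) / 2.
have ud : u z < u z + d by rewrite /d; lra.
have vd : v z < v z + d by rewrite /d; lra.
apply: filterS2 (uA z Az _ ud) (vA z Az _ vd) => y + + Ay.
by move=> /(_ Ay) uy /(_ Ay) vy; move: uy vy; rewrite /d; lra.
Qed.

Lemma continuous_usc (X : topologicalType) (A : set X) u :
  continuous u -> usc A u.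
Proof.
move=> cu z _ c uc.
by apply: filterS (cvgr_lt (u z) (cu z) c uc) => y.
Qed.

Lemma usc_for (X : topologicalType) (A : set X) (u : X -> R) :
  (forall z : X, A z -> {for z, continuous u}) -> usc A u.
Proof.
move=> cu z Az c uc; have cz : u x @[x --> z] --> u z by exact: cu.
by apply: filterS (cvgr_lt (u z) cz c uc) => y.
Qed.

Lemma usc_fst (X Y : topologicalType) (A : set X) (B : set Y) u :
  usc A u -> usc (A `*` B) (fun z => u z.1).
Proof.
move=> uA [a b] [/= Aa Bb] c uc.
exists ([set y | A y -> u y < c], setT).
  by split; [exact: uA|exact: filterT].
by move=> p [/= h _] [/h].
Qed.

Lemma usc_snd (X Y : topologicalType) (A : set X) (B : set Y) u :
  usc B u -> usc (A `*` B) (fun z => u z.2).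
Proof.
move=> uB [a b] [/= Aa Bb] c uc.
exists (setT, [set y | B y -> u y < c]).
  by split; [exact: filterT|exact: uB].
by move=> p [/= _ h] [_ /h].
Qed.

Lemma squeeze_for (X : topologicalType) (g k : X -> R) (x : X) :
  (forall y : X, `|g x - g y| <= k y) -> k x = 0 -> {for x, continuous k} ->
  {for x, continuous g}.
Proof.
move=> gk kx ck; apply/cvgrPdist_le => e e0.
have : \forall y \near x, k y < e by apply: (cvgr_lt (k x) ck); rewrite kx.
by apply: filterS => y ke; exact: le_trans (gk y) (ltW ke).
Qed.

(** The superlevel sets of [u] are nested, hence generate a filter. At a cluster point of it,
    semicontinuity forbids a value below any [u y]. *)
Lemma usc_max (X : topologicalType) (A : set X) (u : X -> R) :
  compact A -> A !=set0 -> usc A u ->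
  exists2 z, A z & forall y, A y -> u y <= u z.
Proof.
move=> cA [a0 Aa0] uA.
pose F : set_system X :=
  [set B | exists2 a, A a & forall y, A y -> u a <= u y -> B y].
have FF : ProperFilter F.
  apply: Build_ProperFilter_ex => [B [a Aa aB]|].
    by exists a; exact: aB.
  split=> [|B B' [a Aa aB] [a' Aa' aB']|B B' BB' [a Aa aB]].
  - by exists a0.
  - have [aa'|/ltW a'a] := leP (u a) (u a').
    + exists a' => // y Ay a'y; split; last exact: aB'.
      by apply: aB => //; exact: le_trans a'y.
    + exists a => // y Ay ay; split; first exact: aB.
      by apply: aB' => //; exact: le_trans ay.
  - by exists a => // y Ay ay; apply: BB'; exact: aB.
have [|z [Az clz]] := cA F FF; first by exists a0.
exists z => // y Ay; rewrite leNgt; apply/negP => zy.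
have Fy : F [set y' | A y' /\ u y <= u y'] by exists y.
have [w [[Aw yw] /(_ Aw)]] := clz _ _ Fy (uA z Az _ zy).
by rewrite ltNge yw.
Qed.

End Semicontinuity.

Section Compactness.
Set Implicit Arguments.
Unset Strict Implicit.
Variables (R : realType) (n : nat).
Local Notation E := (spt R n).

Lemma compact_nsq (A : set E) (z0 : E) (r : R) :
  closed A -> (forall z, A z -> nsq (z - z0) <= r) -> compact A.
Proof.
move=> clA Ar; pose b := Num.sqrt r.
pose I (c : R) := `[c - b, c + b]%classic.
apply: (@subclosed_compact _ _ (I z0.1 `*`
    [set v : vec R n | forall i, I (z0.2 ord0 i) (v ord0 i)])) => //.
  apply: compact_setX; first exact: segment_compact.
  by apply: (@rV_compact _ _ (fun i => I (z0.2 ord0 i))) => i; exact: segment_compact.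
have Iabs (c x : R) : x ^+ 2 <= r -> I c (c + x).
  move=> xr; have : `|x| <= b by rewrite /b -sqrtr_sqr ler_wsqrtr.
  by rewrite ler_norml /I /= in_itv /=; lra.
move=> z /Ar zr; split => /=.
  have := Iabs z0.1 (z - z0).1 (le_trans (nsq_fst _) zr).
  by rewrite /= addrC subrK.
move=> i; have := Iabs (z0.2 ord0 i) ((z - z0).2 ord0 i).
have -> : (z - z0).2 ord0 i = z.2 ord0 i - z0.2 ord0 i by rewrite !mxE.
rewrite [_ + (_ - _)]addrC subrK; apply; apply: le_trans zr.
apply: le_trans (nsq_snd _).
rewrite -[leLHS]real_normK ?num_real// lerXn2r ?nnegrE ?enorm_ge0//.
by have := coord_enorm (z - z0).2 i; rewrite /= !mxE.
Qed.

Lemma continuous_nsqB (z : E) : continuous (fun y : E => nsq (y - z)).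
Proof.
move=> y; apply: (@continuous_comp _ _ _ (fun y : E => y - z : E) (@nsq R n)).
  by apply: cvgB; [exact: cvg_id|exact: cvg_cst].
exact: continuous_nsq.
Qed.

Lemma closed_sublevel (f : E -> R) c : continuous f -> closed [set z | f z <= c].
Proof.
move=> cf; apply: (@closed_comp _ _ f [set x | x <= c]); last exact: closed_le.
by move=> x _; exact: cf.
Qed.

Lemma compact_cball (z : E) (r : R) : compact [set y : E | nsq (y - z) <= r].
Proof.
by apply: (@compact_nsq _ z r) => //; apply/closed_sublevel/continuous_nsqB.
Qed.

(** Replaces a limit in the doubling parameter: pairs violating [W] at ever smaller distance would
    cluster at a point of the diagonal, around which [W] holds. *)
Lemma lebesgue_number_diag (C : set E) (W : E -> E -> Prop) : compact C ->
  (forall w, C w -> exists2 r, 0 < r & forall z z',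
     nsq (z - w) < r -> nsq (z' - w) < r -> W z z') ->
  exists2 d, 0 < d & forall z z', C z -> C z' -> nsq (z - z') <= d -> W z z'.
Proof.
move=> cC HW; apply: contrapT => noW.
pose F : set_system E := [set B | exists2 d, 0 < d & forall z z', C z -> C z' ->
  nsq (z - z') <= d -> ~ W z z' -> B z].
have bad d : 0 < d -> exists z z', [/\ C z, C z', nsq (z - z') <= d & ~ W z z'].
  move=> d0; apply: contrapT => nobad; apply: noW; exists d => // z z' Cz Cz' zz'.
  by apply: contrapT => nW; apply: nobad; exists z, z'.
have FF : ProperFilter F.
  apply: Build_ProperFilter_ex => [B [d d0 dB]|].
    have [z [z' [Cz Cz' zz' nW]]] := bad d d0.
    by exists z; exact: dB nW.
  split=> [|B B' [d d0 dB] [d' d0' dB']|B B' BB' [d d0 dB]].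
  - by exists 1.
  - exists (Num.min d d'); first by rewrite lt_min d0.
    move=> z z' Cz Cz'; rewrite le_min => /andP[h h'] nW.
    by split; [exact: dB h nW|exact: dB' h' nW].
  - by exists d => // z z' Cz Cz' h nW; apply: BB'; exact: dB h nW.
have [|w [Cw clw]] := cC F FF; first by exists 1.
have [r r0 Wr] := HW w Cw.
have r40 : 0 < r / 4 by lra.
have Fr : F [set z | exists z', [/\ C z', nsq (z - z') <= r / 4 & ~ W z z']].
  by exists (r / 4) => // z z' *; exists z'.
have Nr : nbhs w [set z | nsq (z - w) < r / 4].
  by apply/near_nsq; exists (r / 4).
have [z [[z' [Cz' zz' nW]] zw]] := clw _ _ Fr Nr.
apply: nW; apply: Wr; first by move: zw => /=; lra.
by have := nsq_tri z' w z; rewrite (nsqB z' z); move: zw => /=; lra.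
Qed.

End Compactness.

(** * Gradients of test functions *)

Section Gradients.
Set Implicit Arguments.
Unset Strict Implicit.
Variables (R : realType) (n : nat).
Local Notation E := (spt R n).
Implicit Types (phi psi : E -> R) (z y h a b : E).

Definition gr phi z a : Prop := is_diff z phi (sdot a : E -> R).

Lemma gr_eq phi psi z a b : gr phi z a -> phi =1 psi -> a = b -> gr psi z b.
Proof. by move=> ga /funext <- <-. Qed.

Lemma gr_of phi z a (df : E -> R) : is_diff z phi df -> df =1 sdot a -> gr phi z a.
Proof. by move=> d /funext e; apply: is_diff_eq d e. Qed.

Lemma gr_cst (c : R) z : gr (fun _ => c) z 0.
Proof.
apply: (gr_of (is_diff_cst c z)) => h.
by rewrite -(scale0r (0 : E)) sdotZl mul0r.
Qed.

Lemma grD phi psi z a b :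
  gr phi z a -> gr psi z b -> gr (fun y => phi y + psi y) z (a + b).
Proof.
by move=> ga gb; apply: (gr_of (is_diffD ga gb)) => h; rewrite sdotDl.
Qed.

Lemma grN phi z a : gr phi z a -> gr (fun y => - phi y) z (- a).
Proof. by move=> ga; apply: (gr_of (is_diffN ga)) => h; rewrite sdotNl. Qed.

Lemma grZ (c : R) phi z a : gr phi z a -> gr (fun y => c * phi y) z (c *: a).
Proof. by move=> ga; apply: (gr_of (is_diffZ c ga)) => h; rewrite sdotZl. Qed.

Lemma grM phi psi z a b : gr phi z a -> gr psi z b ->
  gr (fun y => phi y * psi y) z (phi z *: b + psi z *: a).
Proof.
move=> ga gb; apply: (gr_of (is_diffM ga gb)) => h.
by rewrite sdotDl !sdotZl.
Qed.

Lemma gr_expR phi z a : gr phi z a ->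
  gr (fun y => expR (phi y)) z (expR (phi z) *: a).
Proof.
move=> ga; have de : differentiable (@expR R) (phi z).
  exact/derivable1_diffP/derivable_expR.
apply: (gr_of (is_diff_comp ga (differentiableP de))) => h.
rewrite /= diff1E// sdotZl derive1E derive_val.
by rewrite /GRing.scale /= mulrC.
Qed.

Lemma gr_fst z : gr (fun y => y.1) z (1, 0).
Proof.
have lf : linear (fst : E -> R) by move=> c u v.
pose L : {linear E -> R} := HB.pack (fst : E -> R) (GRing.isLinear.Build _ _ _ _ _ lf).
have cL : continuous L by move=> u; exact: cvg_fst.
have := differentiableP (linear_differentiable z cL).
rewrite (diff_lin z cL) => dL; apply: (gr_of dL) => h.
 rewrite /sdot /= mul1r.
by rewrite -(scale0r (0 : vec R n)) dotvZl mul0r addr0.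
Qed.

Lemma gr_dotv z : gr (fun y => dotv y.2 y.2) z (0, 2 *: z.2).
Proof.
pose c (i : 'I_n) (y : E) : R := y.2 ord0 i.
have dc i y : is_diff y (c i) (c i).
  have lf : linear (c i) by move=> k u v; rewrite /c /= !mxE.
  pose L : {linear E -> R} := HB.pack (c i) (GRing.isLinear.Build _ _ _ _ _ lf).
  have cL : continuous L.
    move=> u; apply: (@continuous_comp _ _ _ snd (fun x : vec R n => x ord0 i)).
      exact: cvg_snd.
    exact: coord_continuous.
  have := differentiableP (linear_differentiable y cL).
  by rewrite (diff_lin y cL).
have -> : (fun y : E => dotv y.2 y.2) = \sum_(i < n) (c i * c i).
  by apply/funext => y; rewrite fct_sumE.
have d : is_diff z (\sum_(i < n) (c i * c i))
    (\sum_(i < n) (c i z *: c i + c i z *: c i)).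
  elim/big_ind2 : _ => [|f df g dg If Ig|i _]; first exact: (is_diff_cst 0).
    exact: (is_diffD If Ig).
  exact: (is_diffM (dc i z) (dc i z)).
apply: (gr_of d) => h.
rewrite /sdot /= mul0r add0r dotvZl fct_sumE /dotv mulr_sumr.
apply: eq_bigr => i _.
by rewrite -[LHS]/(c i z * c i h + c i z * c i h) /c /=; ring.
Qed.

Lemma gr_nsq (z0 : E) z : gr (fun y => nsq (y - z0)) z (2 *: (z - z0)).
Proof.
have g0 (y : E) : gr (@nsq R n) y (2 *: y).
  apply: (gr_eq (grD (grM (gr_fst y) (gr_fst y)) (gr_dotv y))) => //.
  case: y => t x; apply/pair_equal_spec; split => /=.
    by rewrite /GRing.scale /=; ring.
  by rewrite !scaler0 !add0r.
have d1 : is_diff z (fun y : E => y - z0 : E) (id - 0).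
  exact: (is_diffB (is_diff_id z) (is_diff_cst z0 z)).
apply: (gr_of (is_diff_comp d1 (g0 (z - z0)))) => h /=;
by rewrite fctE subr0.
Qed.

Lemma gr_dir phi z a h (e : R) : gr phi z a -> 0 < e ->
  exists2 s0, 0 < s0 & forall s, 0 < s -> s < s0 ->
    `|phi (z + s *: h) - phi z - s * sdot a h| <= e * s.
Proof.
move=> ga e0; have [dphi dv] := ga.
have := @diff_derivable _ _ _ phi z h dphi; rewrite /derivable.
have := @deriveE _ _ _ phi z h dphi; rewrite /derive dv.
move=> <- /cvgrPdist_le /(_ e e0).
rewrite -near_map /= => /nbhs_ballP [s0 /= s00 Hs0]; exists s0 => // s sp ss.
have := Hs0 s; rewrite -ball_normE /ball_ /= sub0r normrN gtr0_norm// => /(_ ss).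
rewrite gt_eqF// => /(_ isT).
rewrite [z + _]addrC distrC => H.
set D := phi _ - _ in H *; set L := lim _ in H *.
have -> : D - s * L = s * (s^-1 *: D - L).
  by rewrite /GRing.scale /=; field; rewrite gt_eqF.
by rewrite normrM (gtr0_norm sp) mulrC ler_pM2r.
Qed.

Lemma near_line (P : E -> Prop) z h : (\forall y \near z, P y) ->
  exists2 s0 : R, 0 < s0 & forall s, 0 < s -> s < s0 -> P (z + s *: h).
Proof.
move=> /near_nsq[r r0 Pr]; exists (Num.min 1 (r / (1 + nsq h))).
  by rewrite lt_min ltr01 divr_gt0// ltr_wpDr ?nsq_ge0.
move=> s s0; rewrite lt_min => /andP[s1]; rewrite ltr_pdivlMr; last first.
  by rewrite ltr_wpDr ?nsq_ge0.
move=> sr; apply: Pr; rewrite addrAC subrr add0r nsqZ.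
have := nsq_ge0 h; nra.
Qed.

Lemma nsq_eq0 z : nsq z <= 0 -> z = 0.
Proof.
move=> z0; apply/eqP; rewrite -normr_eq0 -sqrf_eq0 eq_le sqr_ge0 andbT.
exact: le_trans (norm_sq_le_nsq _) z0.
Qed.

(** If [a - b] were nonzero, moving along it would increase [phi - psi] at the rate
    [nsq (a - b)]. *)
Lemma gr_max phi psi z a b : gr phi z a -> gr psi z b ->
  (\forall y \near z, phi y - psi y <= phi z - psi z) -> a = b.
Proof.
move=> ga gb mx; apply/eqP; rewrite -subr_eq0; apply/eqP/nsq_eq0.
rewrite leNgt; apply/negP; set d := a - b => d0.
have e0 : 0 < nsq d / 4 by lra.
have [s1 s10 H1] := gr_dir d ga e0.
have [s2 s20 H2] := gr_dir d gb e0.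
have [s3 s30 H3] := near_line d mx.
pose s := Num.min s1 (Num.min s2 s3) / 2.
have m0 : 0 < Num.min s1 (Num.min s2 s3) by rewrite !lt_min s10 s20.
have sm : s < Num.min s1 (Num.min s2 s3) by rewrite /s; lra.
move: sm; rewrite !lt_min => /and3P[ss1 ss2 ss3].
have s0 : 0 < s by rewrite /s; lra.
have := H1 s s0 ss1; have := H2 s s0 ss2; have := H3 s s0 ss3.
have -> : sdot a d = nsq d + sdot b d by rewrite /nsq -sdotDl /d subrK.
rewrite !ler_norml => m /andP[_ +] /andP[+ _].
by have := mulr_gt0 s0 d0; move: m; lra.
Qed.

Definition C1g phi (G : E -> E) : Prop := (forall z, gr phi z (G z)) /\ continuous G.

Lemma gr_continuous phi z a : gr phi z a -> {for z, continuous phi}.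
Proof. by case=> d _; exact: differentiable_continuous. Qed.

Lemma C1g_continuous phi G : C1g phi G -> continuous phi.
Proof. by move=> [g _] z; exact: gr_continuous (g z). Qed.

Lemma C1gD phi psi G G' :
  C1g phi G -> C1g psi G' -> C1g (fun y => phi y + psi y) (fun y => G y + G' y).
Proof.
move=> [g c] [g' c']; split => z; first exact: grD.
exact: (cvgD (c z) (c' z)).
Qed.

Lemma C1gN phi G : C1g phi G -> C1g (fun y => - phi y) (fun y => - G y).
Proof.
by move=> [g c]; split => z; [exact: grN|exact: (cvgN (c z))].
Qed.

Lemma C1gZ (k : R) phi G : C1g phi G -> C1g (fun y => k * phi y) (fun y => k *: G y).
Proof.
by move=> [g c]; split => z; [exact: grZ|exact: (cvgZ (cvg_cst k) (c z))].
Qed.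

Lemma C1gM phi psi G G' : C1g phi G -> C1g psi G' ->
  C1g (fun y => phi y * psi y) (fun y => phi y *: G' y + psi y *: G y).
Proof.
move=> [g c] [g' c']; split => z; first exact: grM.
have cp := gr_continuous (g z); have cq := gr_continuous (g' z).
exact: (cvgD (cvgZ cp (c' z)) (cvgZ cq (c z))).
Qed.

Lemma C1g_expR phi G : C1g phi G ->
  C1g (fun y => expR (phi y)) (fun y => expR (phi y) *: G y).
Proof.
move=> [g c]; split => z; first exact: gr_expR.
apply: cvgZ (c z); apply: (@continuous_comp _ _ _ phi).
  exact: gr_continuous (g z).
exact: continuous_expR.
Qed.

Lemma C1g_cst (c : R) : C1g (fun _ => c) (fun _ => 0).
Proof. by split => z; [exact: gr_cst|exact: cvg_cst]. Qed.

Lemma C1g_fst : C1g (fun y => y.1) (fun _ => (1, 0)).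
Proof. by split => z; [exact: gr_fst|exact: cvg_cst]. Qed.

Lemma C1g_dotv : C1g (fun y => dotv y.2 y.2) (fun y => (0, 2 *: y.2)).
Proof.
split => z; first exact: gr_dotv.
have cs : {for z, continuous (snd : E -> vec R n)} by exact: cvg_snd.
exact: (cvg_pair (cvg_cst (0 : R)) (cvgZ (cvg_cst (2 : R)) cs)).
Qed.

Lemma C1g_nsq (z0 : E) : C1g (fun y => nsq (y - z0)) (fun y => 2 *: (y - z0)).
Proof.
split => z; first exact: gr_nsq.
exact: (cvgZ (cvg_cst (2 : R)) (cvgB cvg_id (cvg_cst z0))).
Qed.

Lemma C1g_eq phi psi G G' : C1g phi G -> phi =1 psi -> G =1 G' -> C1g psi G'.
Proof. by move=> c /funext <- /funext <-. Qed.

End Gradients.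

(** * Sub- and superdifferentials *)

Section ContinuityAtPoint.
Set Implicit Arguments.
Unset Strict Implicit.
Implicit Types X U W Z : topologicalType.

Lemma for_comp X U Z (f : X -> U) (g : U -> Z) x :
  {for x, continuous f} -> {for f x, continuous g} ->
  {for x, continuous (fun y => g (f y))}.
Proof. exact: continuous_comp. Qed.

Lemma for_fst X U W (f : X -> U * W) x :
  {for x, continuous f} -> {for x, continuous (fun y => (f y).1)}.
Proof. by move=> cf; apply: (for_comp cf); exact: cvg_fst. Qed.

Lemma for_snd X U W (f : X -> U * W) x :
  {for x, continuous f} -> {for x, continuous (fun y => (f y).2)}.
Proof. by move=> cf; apply: (for_comp cf); exact: cvg_snd. Qed.

Lemma for_pair X U W (f : X -> U) (g : X -> W) x :
  {for x, continuous f} -> {for x, continuous g} ->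
  {for x, continuous (fun y => (f y, g y))}.
Proof. by move=> cf cg; exact: (cvg_pair cf cg). Qed.

Lemma for_row (R : realType) n X (f : X -> 'rV[R]_n) x :
  (forall i, {for x, continuous (fun y => f y ord0 i)}) ->
  {for x, continuous f}.
Proof.
move=> cf; apply/cvg_ballP => eps eps0.
have H : \forall y \near x, forall i, ball (f x ord0 i) eps (f y ord0 i).
  apply: (@filter_forall X 'I_n (fun i y => ball (f x ord0 i) eps (f y ord0 i))
    (nbhs x) (nbhs_filter x)) => i.
  by have /cvg_ballP := cf i; exact.
apply: filterS H => y hy; split => // i j; rewrite (ord1 i); exact: hy.
Qed.

End ContinuityAtPoint.

(** * Test functions and the differential operator *)

Section Tests.
Set Implicit Arguments.
Unset Strict Implicit.
Variables (R : realType) (n : nat).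
Local Notation E := (spt R n).
Local Notation V := (vec R n).
Implicit Types (H : V -> V -> R) (u phi : E -> R) (G : E -> E) (z y a : E).

Definition Fop H z a : R := a.1 + H z.2 a.2.

Definition Hlip (M : R) H : Prop :=
  [/\ 0 <= M,
      forall (x p q : V), `|H x p - H x q| <= M * (1 + enorm x) * enorm (p - q) &
      forall (x y p : V), `|H x p - H y p| <= M * (1 + enorm p) * enorm (x - y)].

(** The Hamiltonian of the equation for [- v]: a supersolution [v] for [H] corresponds to a
    subsolution [- v] for [negH H]. *)
Definition negH H : V -> V -> R := fun x p => - H x (- p).

Lemma Hlip_neg M H : Hlip M H -> Hlip M (negH H).
Proof.
move=> [M0 h1 h2]; split => // x p q; rewrite /negH.
  rewrite -opprD normrN; apply: le_trans (h1 _ _ _) _.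
  by rewrite -opprD enormN.
by rewrite -opprD normrN; apply: le_trans (h2 _ _ _) _; rewrite enormN.
Qed.

Lemma negHK H : negH (negH H) = H.
Proof. by apply/funext => x; apply/funext => p; rewrite /negH !opprK. Qed.

Lemma Fop_neg H z a : Fop (negH H) z (- a) = - Fop H z a.
Proof. by rewrite /Fop /negH /= opprK opprD. Qed.

(** Joint continuity of [H] comes from the two Lipschitz bounds, through the intermediate value
    [H y.2 (G z).2]. *)
Lemma Fop_continuous M H G z : Hlip M H -> {for z, continuous G} ->
  {for z, continuous (fun y => Fop H y (G y))}.
Proof.
move=> [M0 h1 h2] cG.
have cG1 : {for z, continuous (fun y => (G y).1)} := for_fst cG.
have cG2 : {for z, continuous (fun y => (G y).2)} := for_snd cG.
have cs : {for z, continuous (snd : E -> V)} by exact: cvg_snd.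
apply: (cvgD cG1).
pose g (y : E) := M * (1 + enorm y.2) * enorm ((G y).2 - (G z).2)
  + M * (1 + enorm (G z).2) * enorm (y.2 - z.2).
have en (f : E -> V) : {for z, continuous f} -> {for z, continuous (fun y => enorm (f y))}.
  by move=> cf; apply: (for_comp cf); exact: continuous_enorm.
have cg : {for z, continuous g}.
  apply: cvgD; apply: cvgM.
  - by apply: cvgM; [exact: cvg_cst|apply: cvgD; [exact: cvg_cst|exact: en cs]].
  - by apply: (en (fun y => (G y).2 - (G z).2)); exact: (cvgB cG2 (cvg_cst _)).
  - exact: cvg_cst.
  - by apply: (en (fun y => y.2 - z.2)); exact: (cvgB cs (cvg_cst _)).
have gz : g z = 0.
  rewrite /g !subrr; have -> : enorm (0 : V) = 0; last by rewrite !mulr0 addr0.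
  by rewrite -(scale0r (0 : V)) enormZ normr0 mul0r.
apply/cvgrPdist_le => e e0.
have : \forall y \near z, g y < e by apply: (cvgr_lt (g z) cg); rewrite gz.
apply: filterS => y gy.
apply: le_trans (ltW gy); rewrite distrC.
rewrite -(subrKA (H y.2 (G z).2)); apply: le_trans (ler_normD _ _) _.
by apply: lerD; [exact: h1|exact: h2].
Qed.

(* The smallest and the largest of the classes of test functions considered:
   the superdifferential of [Defs] lies between the two. *)
Definition gsup u z a : Prop := exists phi G,
  [/\ C1g phi G, \forall y \near z, u y - phi y <= u z - phi z & a = G z].

Definition lsup u z a : Prop := exists phi G,
  [/\ \forall y \near z, gr phi y (G y) /\ {for y, continuous G},
      \forall y \near z, u y - phi y <= u z - phi z & a = G z].

Definition gsubsol H (D : set E) u : Prop :=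
  forall z, D z -> forall a, gsup u z a -> Fop H z a <= 0.

Definition lsubsol H (D : set E) u : Prop :=
  forall z, D z -> forall a, lsup u z a -> Fop H z a <= 0.

Lemma gsup_lsup u z a : gsup u z a -> lsup u z a.
Proof.
move=> [phi [G [[g c] mx ->]]]; exists phi, G; split => //.
by near=> y; split; [exact: g|exact: c].
Unshelve. all: by end_near.
Qed.

Lemma lsubsol_gsubsol H D u : lsubsol H D u -> gsubsol H D u.
Proof. by move=> s z Dz a /gsup_lsup; exact: s. Qed.

(** A test touching [u] from above at [z] touches the smaller [v] too. This transfers inequalities
    between functions that agree near a point, and to the active branch of a maximum. *)
Lemma lsup_le u v z a :
  (\forall y \near z, v y <= u y) -> v z = u z -> lsup u z a -> lsup v z a.
Proof.
move=> uv uvz [phi [G [g mx ->]]]; exists phi, G; split => //.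
by apply: filterS2 uv mx => y; rewrite uvz; lra.
Qed.

Lemma lsup_gr phi z a b : gr phi z a -> lsup phi z b -> a = b.
Proof.
move=> ga [psi [G [g mx ->]]]; apply: gr_max ga _ mx.
by have [] := nbhs_singleton g.
Qed.

Lemma open_strip (T : R) : open (@strip_open R n T).
Proof.
have -> : @strip_open R n T = fst @^-1` `]0, T[%classic.
  by apply/seteqP; split=> z; rewrite /strip_open /= in_itv.
by apply: open_comp => [z _|]; [exact: cvg_fst|exact: interval_open].
Qed.

Lemma sdot_continuous G z y : {for z, continuous G} ->
  {for z, continuous (fun w => sdot (G w) y)}.
Proof.
move=> cG; apply: (@for_comp _ _ _ G (fun w => sdot w y) z cG).
have d : differentiable (fun w : E => nsq (w - - y)) (G z).
  by have [] := gr_nsq (- y) (G z).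
have d2 : differentiable (fun w : E => nsq (w - y)) (G z).
  by have [] := gr_nsq y (G z).
(* Polarization reduces the pairing to [nsq], whose differentiability is known. *)
have -> : (fun w => sdot w y) =
    (fun w => 4^-1 * (nsq (w - - y) - nsq (w - y))).
  apply/funext => w; rewrite /nsq !sdotE opprK (sdotC y w); by field.
have c := differentiable_continuous d; have c2 := differentiable_continuous d2.
exact: (cvgM (cvg_cst (4^-1 : R)) (cvgB c c2)).
Qed.

Lemma near_continuous u phi z : (\forall y \near z, u y = phi y) ->
  {for z, continuous u} -> {for z, continuous phi}.
Proof.
move=> uphi cu; apply/cvgrPdist_le => e e0.
have /cvgrPdist_le /(_ e e0) cu' := cu.
have uz := nbhs_singleton uphi.
by apply: filterS2 uphi cu' => y <-; rewrite uz.
Qed.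

(** The differential is determined by its values on the basis vectors, so continuity in every
    direction amounts to continuity of one gradient map. *)
Lemma C1_onP T phi : C1_on (strip_open T) phi <->
  exists G, forall y, strip_open T y -> gr phi y (G y) /\ {for y, continuous G}.
Proof.
split; last first.
  move=> [G Gc] y Oy; have [g c] := Gc y Oy; split; first by case: g.
  move=> h; apply: (@near_continuous (fun w => sdot (G w) h)).
    apply: filterS (open_nbhs_nbhs (conj (@open_strip T) Oy)) => w /Gc [gw _].
    by case: gw => _ ->.
  exact: sdot_continuous.
move=> C1; pose e i : E := (0, delta_mx ord0 i).
pose G y : E := (('d phi y : E -> R) (1, 0), \row_i ('d phi y : E -> R) (e i)).
have GE y h : ('d phi y : E -> R) h = sdot (G y) h.
  have {1}-> : h = h.1 *: (1, 0) + \sum_i h.2 ord0 i *: e i.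
    rewrite [LHS]surjective_pairing; apply/pair_equal_spec; split => /=.
      rewrite (raddf_sum fst) /= big1 => [|i _]; last exact: mulr0.
      by rewrite addr0 /GRing.scale /= mulr1.
    rewrite (raddf_sum snd) /= scaler0 add0r [LHS]row_sum_delta.
    by apply: eq_bigr.
  rewrite linearD linearZ linear_sum /= /sdot /dotv mulrC; congr (_ + _).
  by apply: eq_bigr => i _; rewrite linearZ /= mxE mulrC.
exists G => y Oy; have [d c] := C1 y Oy; split.
  by apply: (gr_of (differentiableP d)) => h; exact: GE.
apply: for_pair; first exact: c.
apply: for_row => i.
have -> : (fun w => (\row_j ('d phi w : E -> R) (e j)) ord0 i) =
  (fun w => ('d phi w : E -> R) (e i)) by apply/funext => w; rewrite mxE.
exact: c.
Qed.

Lemma gr_has_grad phi z a (b : R) (p : V) :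
  gr phi z a -> has_grad phi z b p -> a = (b, p).
Proof.
move=> [_ d] hg; apply/eqP; rewrite -subr_eq0; apply/eqP/nsq_eq0.
rewrite {1}/nsq sdotDl sdotNl -[X in X - _]/((sdot a : E -> R) (a - (b, p))).
by rewrite -d hg subrr.
Qed.

Lemma has_gradP phi z (b : R) (p : V) : gr phi z (b, p) -> has_grad phi z b p.
Proof. by move=> [_ d] h; rewrite d. Qed.

Lemma superdiffP T u z (b : R) (p : V) : strip_open T z ->
  superdiff T u z b p <-> exists phi G,
    [/\ forall y, strip_open T y -> gr phi y (G y) /\ {for y, continuous G},
        \forall y \near z, u y - phi y <= u z - phi z & G z = (b, p)].
Proof.
move=> Oz; split => [[phi [/C1_onP[G Gc] [mx hg]]]|[phi [G [Gc mx Gz]]]].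
  exists phi, G; split => //; exact: gr_has_grad (Gc z Oz).1 hg.
exists phi; split; first by apply/C1_onP; exists G.
by split => //; apply: has_gradP; rewrite -Gz; case: (Gc z Oz).
Qed.

Lemma subdiffP T u z (b : R) (p : V) : strip_open T z ->
  subdiff T u z b p <-> superdiff T (fun y => - u y) z (- b) (- p).
Proof.
move=> Oz; split=> [[phi [/C1_onP[G Gc] [mx hg]]]|].
  apply/superdiffP => //; exists (fun y => - phi y), (fun y => - G y).
  split=> [y /Gc [g c]||]; first by split; [exact: grN|exact: (cvgN c)].
    by apply: filterS mx => y; lra.
  by rewrite (gr_has_grad (Gc z Oz).1 hg).
move=> /(superdiffP _ _ _ Oz) [phi [G [Gc mx Gz]]].
exists (fun y => - phi y); split.
  apply/C1_onP; exists (fun y => - G y) => y /Gc [g c].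
  by split; [exact: grN|exact: (cvgN c)].
split; first by apply: filterS mx => y; lra.
apply: has_gradP; have := grN (Gc z Oz).1.
by rewrite Gz; congr gr; rewrite -[RHS]opprK.
Qed.

Lemma gsup_superdiff T u z a :
  strip_open T z -> gsup u z a -> superdiff T u z a.1 a.2.
Proof.
move=> Oz [phi [G [[g c] mx ->]]]; apply/superdiffP => //.
exists phi, G; split => //; last by case: (G z).
by move=> y _; split; [exact: g|exact: c].
Qed.

Lemma superdiff_lsup T u z (b : R) (p : V) :
  strip_open T z -> superdiff T u z b p -> lsup u z (b, p).
Proof.
move=> Oz /(superdiffP _ _ _ Oz) [phi [G [Gc mx Gz]]].
exists phi, G; split => //.
by apply: filterS (open_nbhs_nbhs (conj (@open_strip T) Oz)).
Qed.

(** * Time reversal of test functions and differentials *)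

Definition trev (T : R) z : E := (T - z.1, z.2).

Lemma trevK T : involutive (trev T).
Proof.
by move=> [t x]; rewrite /trev /= opprB addrC subrK.
Qed.

Lemma strip_open_rev T z : strip_open T z -> strip_open T (trev T z).
Proof. by rewrite /strip_open /trev /= => /andP[? ?]; apply/andP; lra. Qed.

Lemma strip_closed_rev T z : strip_closed T z -> strip_closed T (trev T z).
Proof. by rewrite /strip_closed /trev /= => /andP[? ?]; apply/andP; lra. Qed.

Lemma rev_continuous T : continuous (trev T).
Proof.
move=> z; have c1 : {for z, continuous (fst : E -> R)} by exact: cvg_fst.
have c2 : {for z, continuous (snd : E -> V)} by exact: cvg_snd.
exact: (for_pair (cvgB (cvg_cst T) c1) c2).
Qed.

Lemma gr_rev T phi z a :
  gr phi (trev T z) a -> gr (phi \o trev T) z (- a.1, a.2).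
Proof.
move=> ga.
have cs : continuous (snd : E -> V) by move=> y; exact: cvg_snd.
have ds : is_diff z (snd : E -> V) (snd : E -> V).
  have := differentiableP (linear_differentiable z cs).
  by rewrite (diff_lin z cs).
have d := is_diff_pair (is_diffB (is_diff_cst T z) (gr_fst z)) ds.
have dc : is_diff z (phi \o trev T) _ := is_diff_comp d ga.
apply: (gr_of dc) => h.
rewrite -[LHS]/(sdot a ((0 - sdot (1, 0) h), h.2)) /sdot /=.
have -> : dotv (0 : V) h.2 = 0 by rewrite -(scale0r (0 : V)) dotvZl mul0r.
ring.
Qed.

Lemma superdiff_rev T u z (b : R) (p : V) : strip_open T z ->
  superdiff T u z b p -> superdiff T (u \o trev T) (trev T z) (- b) p.
Proof.
move=> Oz /(superdiffP _ _ _ Oz) [phi [G [Gc mx Gz]]].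
apply/superdiffP; first exact: strip_open_rev.
exists (phi \o trev T), (fun y => (- (G (trev T y)).1, (G (trev T y)).2)).
split; last by rewrite trevK Gz.
- move=> y Oy; have [g c] := Gc _ (strip_open_rev Oy); split; first exact: gr_rev.
  have cG : {for y, continuous (fun y => G (trev T y))}.
    exact: (for_comp (@rev_continuous T y) c).
  exact: (for_pair (cvgN (for_fst cG)) (for_snd cG)).
- rewrite /= trevK.
  have := @rev_continuous T (trev T z); rewrite /continuous_at trevK => /(_ _ mx).
  exact.
Qed.

Lemma subdiff_rev T u z (b : R) (p : V) : strip_open T z ->
  subdiff T u z b p -> subdiff T (u \o trev T) (trev T z) (- b) p.
Proof.
move=> Oz /(subdiffP _ _ _ Oz) /(superdiff_rev Oz) h.
by apply/subdiffP => //; exact: strip_open_rev.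
Qed.

End Tests.

(** * Comparison *)

Section Comparison.
Set Implicit Arguments.
Unset Strict Implicit.
Variables (R : realType) (n : nat).
Local Notation E := (spt R n).
Local Notation V := (vec R n).
Variables (M : R) (H : V -> V -> R).
Hypothesis HM : Hlip M H.
Implicit Types (z y w : E).

(* The sublevel sets of [cone delta] shrink at the speed [M (1 + |x|)], the
   maximal speed of propagation: no lateral boundary condition is needed. *)
Definition cone (delta : R) y : R :=
  y.1 + delta * (expR (4 * M * y.1) * (1 + dotv y.2 y.2)).

Definition cone_grad (delta : R) y : E :=
  (1 + delta * (4 * M * (expR (4 * M * y.1) * (1 + dotv y.2 y.2))),
   (2 * delta * expR (4 * M * y.1)) *: y.2).

Lemma C1g_cone delta : C1g (cone delta) (cone_grad delta).
Proof.
have fst1 := C1g_fst R n; have dv := C1g_dotv R n.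
have e := C1g_expR (C1gZ (4 * M) fst1).
apply: (C1g_eq (C1gD fst1 (C1gZ delta (C1gM e (C1gD (C1g_cst n 1) dv))))) => // y.
apply/pair_equal_spec; split => /=; rewrite /GRing.scale /=; first ring.
by apply/rowP => i; rewrite !mxE /=; ring.
Qed.

Lemma cone_continuous delta : continuous (cone delta).
Proof. exact: C1g_continuous (C1g_cone delta). Qed.

Let M0 : 0 <= M. Proof. by case: HM. Qed.

(** With [r = enorm y.2] and up to the factor [delta * expR (4 * M * y.1)], the speed bound costs
    [2 * M * r * (1 + r)], which the growth in time [4 * M * (1 + r ^+ 2)] covers; hence the rate
    [4 * M] in the exponent. *)
Lemma cone_grad_ge1 delta y : 0 <= delta ->
  1 <= (cone_grad delta y).1 - M * (1 + enorm y.2) * enorm (cone_grad delta y).2.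
Proof.
move=> d0; rewrite /cone_grad /= enormZ ger0_norm; last first.
  by rewrite !mulr_ge0// expR_ge0.
rewrite -enorm_sq; set r := enorm _; set e := expR _.
have : 0 <= M * (delta * e) * (1 + (r - 1) ^+ 2).
  by rewrite !mulr_ge0// ?expR_ge0// addr_ge0// sqr_ge0.
have : 0 <= M * (delta * e) by rewrite !mulr_ge0// expR_ge0.
have := enorm_ge0 y.2; rewrite -/r; nra.
Qed.

Lemma cone_lb delta y : 0 <= delta -> 0 <= y.1 ->
  y.1 + delta * enorm y.2 ^+ 2 <= cone delta y.
Proof.
move=> d0 y0; rewrite /cone lerD2l ler_wpM2l// -enorm_sq.
have : 1 <= expR (4 * M * y.1) by rewrite -expR0 ler_expR !mulr_ge0.
have := sqr_ge0 (enorm y.2); nra.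
Qed.

Lemma compact_cone (delta K : R) : 0 < delta ->
  compact [set y : E | 0 <= y.1 /\ cone delta y <= K].
Proof.
move=> d0; apply: (@compact_nsq _ _ _ 0 (K ^+ 2 + K / delta)).
  suff c0 : closed [set y : E | 0 <= y.1].
    by apply: (closedI c0); exact/closed_sublevel/cone_continuous.
  have -> : [set y : E | 0 <= y.1] = [set y : E | - y.1 <= 0].
    by apply/seteqP; split => y /=; lra.
  apply: (@closed_sublevel _ _ (fun y : E => - y.1)).
  exact: C1g_continuous (C1gN (C1g_fst R n)).
move=> y [y0 yK]; have := cone_lb (ltW d0) y0; rewrite subr0 nsqE => h.
have hx : delta * enorm y.2 ^+ 2 <= K by lra.
have hK : y.1 <= K by have := mulr_ge0 (ltW d0) (sqr_ge0 (enorm y.2)); lra.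
apply: lerD; first by rewrite lerXn2r ?nnegrE //; lra.
by rewrite ler_pdivlMr// mulrC.
Qed.

Definition region0 (delta T : R) : set E := [set y | 0 <= y.1 /\ cone delta y < T].
Definition region (delta T : R) : set E := [set y | 0 < y.1 /\ cone delta y < T].

Lemma region_sub0 delta T : region delta T `<=` region0 delta T.
Proof. by move=> y [/ltW]. Qed.

Lemma near_region delta T z : region delta T z -> \forall y \near z, region delta T y.
Proof.
move=> [z0 zT]; have c1 : {for z, continuous (fun y : E => y.1)}.
  exact: (C1g_continuous (C1g_fst R n)).
have c2 : {for z, continuous (cone delta)} by exact: cone_continuous.
apply: filterS2 (cvgr_gt z.1 c1 0 z0)
  (cvgr_lt _ c2 T zT) => y y0 yT; split => //.
Qed.

(* Doubling of variables.  The penalty [P] is at least [B >= u + v] on the lateral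
   boundary [cone = K] and less than [u + v] at [zs], so that the doubled maximum
   is interior; there [P] contributes a positive term, [cone] outrunning the speed
   of propagation. *)
Theorem comparison_region (delta T : R) (u v : E -> R) : 0 < delta ->
  usc (region0 delta T) u -> usc (region0 delta T) v ->
  gsubsol H (region delta T) u -> gsubsol (negH H) (region delta T) v ->
  (forall x, region0 delta T (0, x) -> u (0, x) + v (0, x) <= 0) ->
  forall z, region0 delta T z -> u z + v z <= 0.
Proof.
move=> d0 uscu uscv subu subv init zs [zs0 zsT].
rewrite leNgt; apply/negP => s0; set sg := u zs + v zs in s0.
(* A level strictly between that of [zs] and [T]: [C] is compact, stays in the region and contains
   [zs] with room to spare. *)
pose K := (cone delta zs + T) / 2.
have KT : K < T by rewrite /K; lra.
have zsK : cone delta zs < K by rewrite /K; lra.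
pose C : set E := [set y | 0 <= y.1 /\ cone delta y <= K].
have cC : compact C by exact: compact_cone.
have CD : C `<=` region0 delta T by move=> y [? ?]; split => //; lra.
have Czs : C zs by split => //; exact: ltW.
have uscuC := uscS CD uscu; have uscvC := uscS CD uscv.
have cCC : compact (C `*` C) by exact: compact_setX.
have CC0 : (C `*` C) !=set0 by exists (zs, zs).
have [B B1 HB] : exists2 B, 1 <= B & forall y y', C y -> C y' -> u y + v y' <= B.
  have [b _ Hb] := usc_max cCC CC0 (uscD (usc_fst (B := C) uscuC) (usc_snd (A := C) uscvC)).
  exists (1 + `|u b.1 + v b.2|); first by rewrite lerDl.
  move=> y y' Cy Cy'; have := Hb (y, y') (conj Cy Cy') => /=.
  by have := ler_norm (u b.1 + v b.2); lra.
have B0 : 0 < B by lra.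
pose kap := K - cone delta zs; have kap0 : 0 < kap by rewrite /kap; lra.
(* Chosen so that [k * kap = B / sg]: then [P zs = B * expR (- (B / sg))], which is below [sg]
   because [X < expR X]. *)
pose k := B / (sg * kap).
have k0 : 0 < k by rewrite divr_gt0// mulr_gt0.
pose P y := B * expR (k * (cone delta y - K)).
pose GP y := (k * P y) *: cone_grad delta y.
have P0 y : 0 < P y by rewrite mulr_gt0// expR_gt0.
have CP : C1g P GP.
  apply: (C1g_eq (C1gZ B (C1g_expR (C1gZ k (C1gD (C1g_cone delta) (C1g_cst n (- K))))))) => // y.
  by rewrite addr0 /GP /P !scalerA; congr (_ *: _); ring.
have Pzs : P zs < sg.
  have : 1 + k * kap <= expR (k * kap) by exact: expR_ge1Dx.
  have -> : k * kap = B / sg by rewrite /k; field; rewrite !gt_eqF.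
  set X := expR _ => h; have {h} : B / sg < X by move: h; set q := B / sg; lra.
  rewrite ltr_pdivrMr// /P -opprB mulrN -/kap expRN.
  have -> : k * kap = B / sg by rewrite /k; field; rewrite !gt_eqF.
  by rewrite ltr_pdivrMr ?expR_gt0// -/X mulrC.
have cPn : continuous (fun y => - P y) by exact: C1g_continuous (C1gN CP).
have [wh Cwh Hwh] := usc_max cC (ex_intro _ zs Czs)
  (uscD (uscD uscuC uscvC) (continuous_usc (A := C) cPn)).
set S := u wh + v wh + - P wh in Hwh.
have S0 : 0 < S by have := Hwh zs Czs; rewrite -/sg; lra.
(* A lower bound of [k * P] on [C], where [cone] is nonnegative: the strict gain that the doubling
   errors will fail to offset. *)
pose c0 := k * (B * expR (- (k * K))).
have c00 : 0 < c0 by rewrite mulr_gt0// mulr_gt0// expR_gt0.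
have Pc0 y : C y -> c0 <= k * P y.
  move=> [y0 _]; rewrite ler_pM2l// ler_pM2l// ler_expR.
  have := cone_lb (ltW d0) y0; have := mulr_ge0 (ltW d0) (sqr_ge0 (enorm y.2)).
  move=> h h'; have : 0 <= k * cone delta y by rewrite mulr_ge0 ?(ltW k0)//; lra.
  lra.
(* Makes [2 * (M * rho) <= c0 / 3]. *)
pose rho := c0 / (6 * (M + 1)).
have M1 : 0 < M + 1 by rewrite ltr_wpDl.
have rho0 : 0 < rho by rewrite divr_gt0// mulr_gt0.
pose inn y : Prop := 0 < y.1 /\ cone delta y < K.
(* Pairs near the diagonal exceed the undoubled maximum [S] by at most [rho], and those reaching [S]
   are interior: on the initial face, and where [cone] reaches [K], the undoubled function is at
   most 0, which is less than [S]. *)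
pose W z z' := C z -> C z' -> u z + v z' - P z <= S + rho /\
  (S <= u z + v z' - P z -> inn z /\ inn z').
have [|d dd0 Hd] := @lebesgue_number_diag _ _ C W cC.
  move=> w Cw; have := Hwh w Cw; rewrite -/(u w + v w - P w) => psiS.
  have near_psi c : u w + v w - P w < c -> exists2 r, 0 < r & forall y y',
      nsq (y - w) < r -> nsq (y' - w) < r -> C y -> C y' -> u y + v y' - P y < c.
    move=> psic; pose g := (c - (u w + v w - P w)) / 3.
    have g0 : 0 < g by rewrite /g; lra.
    have /near_nsq[r1 r10 H1] : \forall y \near w, C y -> u y < u w + g.
      by apply: uscuC => //; lra.
    have /near_nsq[r2 r20 H2] : \forall y \near w, C y -> v y < v w + g.
      by apply: uscvC => //; lra.
    have /near_nsq[r3 r30 H3] : \forall y \near w, C y -> - P y < - P w + g.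
      by apply: (continuous_usc cPn) => //; lra.
    exists (Num.min r1 (Num.min r2 r3)); first by rewrite !lt_min r10 r20.
    move=> y y'; rewrite !lt_min => /and3P[y1 _ y3] /and3P[_ y2 _] Cy Cy'.
    have := H1 y y1 Cy; have := H2 y' y2 Cy'; have := H3 y y3 Cy.
    by rewrite /g; lra.
  have [iw|niw] := pselect (inn w).
    have [r r0 Hr] := near_psi (S + rho) ltac:(lra).
    have /near_nsq[r' r'0 Hr'] : \forall y \near w, inn y by exact: near_region.
    exists (Num.min r r'); first by rewrite lt_min r0.
    move=> y y'; rewrite !lt_min => /andP[yr yr'] /andP[y'r y'r'] Cy Cy'.
    by split; [exact/ltW/Hr|split; exact: Hr'].
  have psi0 : u w + v w - P w <= 0.
    have [w0|w0] := eqVneq w.1 0.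
      have ew : w = (0, w.2) by rewrite -w0 -surjective_pairing.
      have := init w.2; rewrite -ew => /(_ (CD _ Cw)); have := P0 w; lra.
    have [wK|wK] := ltP (cone delta w) K.
      by exfalso; apply: niw; split => //; rewrite lt_def w0; case: Cw.
    have := HB w w Cw Cw; have : 1 <= expR (k * (cone delta w - K)).
      by rewrite -expR0 ler_expR mulr_ge0 ?(ltW k0)//; lra.
    by rewrite /P; have := B0; nra.
  have [r r0 Hr] := near_psi S ltac:(lra).
  exists r => // y y' yr y'r Cy Cy'; have := Hr y y' yr y'r Cy Cy'.
  by move=> h; split; lra.
(* The first bound forces [nsq (z - z') <= d], so that [W] applies; the second gives
   [M * enorm (z.2 - z'.2) <= c0 / 3]. *)
pose eps := Num.min (d / (2 * B)) (c0 ^+ 2 / (9 * (2 * M ^+ 2 * rho + 1))).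
have den0 : 0 < 9 * (2 * M ^+ 2 * rho + 1).
  by have := mulr_ge0 (sqr_ge0 M) (ltW rho0); lra.
have eps0 : 0 < eps.
  by rewrite lt_min !divr_gt0 ?exprn_gt0//; lra.
pose i2e := (2 * eps)^-1.
have i2e0 : 0 < i2e by rewrite invr_gt0; lra.
have [[z z'] [/= Cz Cz'] Hmax] : exists2 zz : E * E, (C `*` C) zz & forall y y', C y -> C y' ->
    u y + v y' - P y - i2e * nsq (y - y') <= u zz.1 + v zz.2 - P zz.1 - i2e * nsq (zz.1 - zz.2).
  have cq : continuous (fun p : E * E => - (i2e * nsq (p.1 - p.2))).
    move=> p; have c1 : {for p, continuous (fst : E * E -> E)} by exact: cvg_fst.
    have c2 : {for p, continuous (snd : E * E -> E)} by exact: cvg_snd.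
    have cn : {for p, continuous (fun p : E * E => nsq (p.1 - p.2))}.
      apply: (@for_comp _ _ _ (fun p : E * E => p.1 - p.2) (@nsq R n) p (cvgB c1 c2)).
      exact: continuous_nsq.
    exact: (cvgN (cvgM (cvg_cst i2e) cn)).
  have [zz Czz Hzz] := usc_max cCC CC0 (uscD (uscD (uscD
    (usc_fst (B := C) uscuC) (usc_snd (A := C) uscvC))
    (usc_fst (B := C) (continuous_usc (A := C) cPn)))
    (continuous_usc (A := C `*` C) cq)).
  by exists zz => // y y' Cy Cy'; exact: Hzz (y, y') (conj Cy Cy').
have HmS : S <= u z + v z' - P z - i2e * nsq (z - z').
  by have := Hmax wh wh Cwh Cwh; rewrite subrr nsq0 mulr0 subr0.
have nz := nsq_ge0 (z - z').
have epsd : eps * (2 * B) <= d.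
  by rewrite -ler_pdivlMr ?ge_min ?lexx//; lra.
have zd : nsq (z - z') <= d.
  have : i2e * nsq (z - z') <= B by have := HB z z' Cz Cz'; have := P0 z; lra.
  by rewrite ler_pdivrMl; lra.
have [Wz Iz] := Hd z z' Cz Cz' zd Cz Cz'.
have zrho : i2e * nsq (z - z') <= rho by lra.
have [iz iz'] : inn z /\ inn z' by apply: Iz; have := mulr_ge0 (ltW i2e0) nz; lra.
have near_inn y : inn y -> \forall y' \near y, C y'.
  move=> iy; have : region delta K y by [].
  by move=> /near_region; apply: filterS => y' [? ?]; split; exact: ltW.
pose a := i2e *: (2 *: (z - z')).
(* The whole of [P] is charged to the test function for [u]; the one for [v] carries only the
   quadratic penalty. *)
have Fu : Fop H z (GP z + a) <= 0.
  have Dz : region delta T z by case: iz => ? ?; split => //; lra.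
  apply: (subu z Dz); exists (fun y => P y + i2e * nsq (y - z')),
    (fun y => GP y + i2e *: (2 *: (y - z'))); split; last by [].
    exact: (C1gD CP (C1gZ i2e (C1g_nsq z'))).
  apply: filterS (near_inn z iz) => y Cy; have := Hmax y z' Cy Cz' => /=; lra.
have Fv : 0 <= Fop H z' a.
  have Dz' : region delta T z' by case: iz' => ? ?; split => //; lra.
  rewrite -oppr_le0 -Fop_neg; apply: (subv z' Dz').
  exists (fun y => i2e * nsq (y - z)), (fun y => i2e *: (2 *: (y - z))); split.
  - exact: (C1gZ i2e (C1g_nsq z)).
  - apply: filterS (near_inn z' iz') => y Cy; have := Hmax z y Cz Cy => /=.
    by rewrite (nsqB z y) (nsqB z z'); lra.
  - by rewrite /a -scalerN -scalerN opprB.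
have [_ h1 h2] := HM.
have e1 := h1 z.2 ((GP z).2 + a.2) a.2; rewrite addrK in e1.
have e2 := h2 z.2 z'.2 a.2.
(* Subtracting the two inequalities cancels [a.1] and leaves the gain of [P], at least [c0], against
   the variation of [H] in space. *)
have gap : c0 <= M * (1 + enorm a.2) * enorm (z.2 - z'.2).
  have g1 := cone_grad_ge1 z (ltW d0); have pc := Pc0 z Cz.
  have kP0 : 0 < k * P z by rewrite mulr_gt0.
  have g2 : c0 <= (GP z).1 - M * (1 + enorm z.2) * enorm (GP z).2.
    have -> : (GP z).1 = k * P z * (cone_grad delta z).1 by [].
    have -> : (GP z).2 = (k * P z) *: (cone_grad delta z).2 by [].
    rewrite enormZ gtr0_norm//.
    apply: (le_trans pc); have := ler_wpM2l (ltW kP0) g1; rewrite mulr1; clear; lra.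
  have Fu' : (GP z).1 + a.1 + H z.2 ((GP z).2 + a.2) <= 0 by exact: Fu.
  have Fv' : 0 <= a.1 + H z'.2 a.2 by exact: Fv.
  move: e1 e2; rewrite !ler_norml => /andP[e1 _] /andP[e2 _].
  move: Fu' Fv' e1 e2 g2; clear; lra.
set r := enorm (z.2 - z'.2) in gap.
have r0 : 0 <= r by exact: enorm_ge0.
have rn : r ^+ 2 <= nsq (z - z') by exact: (nsq_snd (z - z')).
have ea : enorm a.2 = i2e * (2 * r).
  by rewrite /a /= !enormZ !gtr0_norm.
have b1 : M * (i2e * r ^+ 2) <= M * rho.
  by apply: ler_wpM2l => //; apply: le_trans zrho; rewrite ler_wpM2l ?(ltW i2e0).
have b2 : 2 * (M * rho) <= c0 / 3.
  have : rho * (6 * (M + 1)) = c0 by rewrite /rho divfK// gt_eqF// mulr_gt0.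
  move: rho0; clear; lra.
have epsc : eps * (9 * (2 * M ^+ 2 * rho + 1)) <= c0 ^+ 2.
  by rewrite -ler_pdivlMr// ge_min lexx orbT.
have r2 : r ^+ 2 <= 2 * eps * rho.
  apply: (le_trans rn); move: zrho; rewrite /i2e ler_pdivrMl ?mulr_gt0//.
have b3 : M * r <= c0 / 3.
  have c03 : 0 <= c0 / 3 by rewrite divr_ge0// ltW.
  have Mr : 0 <= M * r by exact: mulr_ge0.
  rewrite -(@ler_pXn2r _ 2) ?nnegrE//.
  have : M ^+ 2 * r ^+ 2 <= M ^+ 2 * (2 * eps * rho) by rewrite ler_wpM2l ?sqr_ge0.
  rewrite exprMn; move: epsc eps0; clear; nra.
(* The upper bound in [gap] is [M * r + 2 * M * i2e * r ^+ 2], at most two thirds of [c0]. *)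
move: gap; rewrite ea; move: b1 b2 b3 c00; clear; nra.
Qed.

End Comparison.

(** * Passing from subgradients to supergradients *)

Section BarronJensen.
Set Implicit Arguments.
Unset Strict Implicit.
Variables (R : realType) (n : nat).
Local Notation E := (spt R n).
Local Notation V := (vec R n).
Implicit Types (z y w : E).

Lemma le_small_slope (A B c s0 : R) : 0 < s0 -> 0 <= c ->
  (forall s, 0 < s -> s < s0 -> B - s * c <= A) -> B <= A.
Proof.
move=> s00 c0 H; rewrite leNgt; apply/negP => AB.
pose s := Num.min s0 ((B - A) / (c + 1)) / 2.
have m0 : 0 < Num.min s0 ((B - A) / (c + 1)).
  by rewrite lt_min s00 divr_gt0//; lra.
have sm : s < Num.min s0 ((B - A) / (c + 1)) by rewrite /s; lra.
move: sm; rewrite lt_min => /andP[ss0]; rewrite ltr_pdivlMr; last lra.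
have s_gt0 : 0 < s by rewrite /s; lra.
have := H s s_gt0 ss0; move: s_gt0 c0; clear; nra.
Qed.

(* The subgradient is that of [g] at the minimizer of [g + |. - p|^2 / 2k], which
   is within [2 k L] of [p]. *)
Lemma approx_subgradient (g : V -> R) (L : R) (p : V) (eta : R) :
  (forall (p q : V) (l : R), 0 <= l <= 1 ->
     g (l *: p + (1 - l) *: q) <= l * g p + (1 - l) * g q) ->
  0 <= L -> (forall p q, `|g p - g q| <= L * enorm (p - q)) -> 0 < eta ->
  exists q, forall p', g p + dotv q (p' - p) - eta <= g p'.
Proof.
move=> gconv L0 gL eta0.
have L1 : 0 < L + 1 by rewrite ltr_wpDl.
(* Makes [L * (2 * k * L) <= eta]: passing from [p] to the minimizer lowers [g] by at most [eta]. *)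
pose k := eta / (2 * (L + 1) ^+ 2).
have k0 : 0 < k by rewrite divr_gt0// mulr_gt0// exprn_gt0.
(* The minimization runs over space-time with a dummy time component. The squared radius is one more
   than the minimizer can reach, so the minimizer is interior. *)
pose p0 : E := (0, p); pose r := (2 * k * L) ^+ 2 + 1.
pose i2k := (2 * k)^-1; have i2k0 : 0 < i2k by rewrite invr_gt0 mulr_gt0.
have cg (y : E) : {for y, continuous (fun y : E => g y.2)}.
  apply: (@squeeze_for _ _ _ (fun w : E => L * Num.sqrt (nsq (w - y)))).
  - move=> w; apply: le_trans (gL y.2 w.2) _; rewrite ler_wpM2l// -enormN opprB.
    by rewrite -[leLHS]ger0_norm ?enorm_ge0// -sqrtr_sqr ler_wsqrtr//; exact: (nsq_snd (w - y)).
  - by rewrite subrr nsq0 sqrtr0 mulr0.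
  - have ck : {for y, continuous (fun w : E => Num.sqrt (nsq (w - y)))}.
      apply: (@for_comp _ _ _ (fun w : E => nsq (w - y)) (@Num.sqrt R)).
        exact: continuous_nsqB.
      exact: sqrt_continuous.
    exact: (cvgM (cvg_cst L) ck).
have cG : continuous (fun y : E => - (g y.2 + i2k * nsq (y - p0))).
  move=> y; have cn : {for y, continuous (fun y : E => nsq (y - p0))}.
    exact: continuous_nsqB.
  exact: (cvgN (cvgD (cg y) (cvgM (cvg_cst i2k) cn))).
have B0 : [set y : E | nsq (y - p0) <= r] !=set0.
  by exists p0; rewrite /= subrr nsq0 addr_ge0// sqr_ge0.
have [ys /= ysr Hys] := usc_max (compact_cball (z := p0) (r := r)) B0
  (continuous_usc (A := _) cG).
pose s := enorm (ys.2 - p).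
have s0 : 0 <= s by exact: enorm_ge0.
have sn : s ^+ 2 <= nsq (ys - p0) by exact: (nsq_snd (ys - p0)).
have nL : i2k * nsq (ys - p0) <= L * s.
  have := Hys p0; rewrite /= subrr nsq0 mulr0 => /(_ (addr_ge0 (sqr_ge0 _) ler01)).
  by have := gL ys.2 p; rewrite -/s ler_norml => /andP[+ _]; lra.
have nL2 : nsq (ys - p0) <= 2 * k * (L * s).
  have k20 : 0 < 2 * k by rewrite mulr_gt0.
  by rewrite -ler_pdivrMl.
have s2k : s <= 2 * k * L.
  rewrite leNgt; apply/negP; have := mulr_ge0 (ltW k0) L0.
  by move: sn nL2 s0; clear; nra.
have ysr' : nsq (ys - p0) < r.
  rewrite /r; have := mulr_ge0 (ltW k0) L0; move: nL2 s2k s0; clear; nra.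
exists (k^-1 *: (p - ys.2)) => p'.
pose h : E := (0, p' - ys.2).
have nearr : \forall y \near ys, nsq (y - p0) < r.
  by apply: (cvgr_lt _ (@continuous_nsqB _ _ p0 ys)).
have [s1 s10 Hs1] := near_line h nearr.
(* Compare [ys] with points of the segment towards [p'], use convexity of [g], divide by the
   parameter [t] and let it tend to 0. *)
have key : g ys.2 + dotv (k^-1 *: (p - ys.2)) (p' - ys.2) <= g p'.
  apply: (@le_small_slope _ _ (i2k * nsq h) (Num.min s1 1)).
  - by rewrite lt_min s10 ltr01.
  - by rewrite mulr_ge0 ?nsq_ge0// ltW.
  move=> t t0; rewrite lt_min => /andP[ts1 t1].
  have := Hys _ (ltW (Hs1 t t0 ts1)) => /=.
  have -> : ys.2 + t *: (p' - ys.2) = t *: p' + (1 - t) *: ys.2.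
    by rewrite scalerBr scalerBl scale1r addrCA.
  have := gconv p' ys.2 t; rewrite (ltW t0) (ltW t1) => /(_ isT).
  have -> : nsq (ys + t *: h - p0) =
      nsq (ys - p0) + t * (2 * dotv (ys.2 - p) (p' - ys.2)) + t ^+ 2 * nsq h.
    have -> : dotv (ys.2 - p) (p' - ys.2) = sdot (ys - p0) h.
      by rewrite /sdot /= mulr0 add0r.
    by rewrite addrAC nsqDZ.
  have -> : dotv (k^-1 *: (p - ys.2)) (p' - ys.2) =
      - (i2k * (2 * dotv (ys.2 - p) (p' - ys.2))).
    by rewrite dotvZl -opprB dotvNl /i2k; field; rewrite gt_eqF.
  set X := dotv _ _; set Y := nsq h; set Z := nsq _ => c1 c2.
  have : t * (g ys.2 - i2k * (2 * X) - t * (i2k * Y)) <= t * g p'.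
    by move: c1 c2; clear; lra.
  by rewrite ler_pM2l.
apply: le_trans key.
have := gL ys.2 p; rewrite -/s ler_norml => /andP[h1 _].
have Ls : L * s <= eta.
  have : L * s <= L * (2 * k * L) by rewrite ler_wpM2l.
  have : k * (2 * (L + 1) ^+ 2) = eta by rewrite /k divfK// gt_eqF// mulr_gt0// exprn_gt0.
  move: L0 k0; clear; nra.
(* Moving the base point from [ys.2] to [p] only helps: the extra term is [k^-1] times a square. *)
have -> : p' - ys.2 = (p' - p) + (p - ys.2) by rewrite subrKA.
rewrite dotvDr.
have : 0 <= dotv (k^-1 *: (p - ys.2)) (p - ys.2).
  by rewrite dotvZl mulr_ge0 ?dotv_ge0// invr_ge0 ltW.
by move: h1 Ls; clear; lra.
Qed.

Variables (M : R) (H : V -> V -> R).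
Hypothesis HM : Hlip M H.
Hypothesis Hconv : forall (x p q : V) (l : R), 0 <= l <= 1 ->
  H x (l *: p + (1 - l) *: q) <= l * H x p + (1 - l) * H x q.

(* Let [f] be the inf-convolution of [v], [ze] a maximum point of [f - psi], [xi]
   the gradient of [psi] there, and [q] an approximate subgradient of [H ze.2] at
   [xi.2].  At [z = ze - h (1, q)] the paraboloid defining [f z] touches [v] from
   below with a gradient [ze'] whose component along [(1, q)] is almost at least
   that of [xi]; convexity then bounds [Fop H ze xi] by [Fop H ze ze'] up to a
   small error. *)
Theorem barron_jensen (O : set E) (v : E -> R) : open O ->
  (forall z, O z -> {for z, continuous v}) ->
  (forall z a, O z -> gsup (fun y => - v y) z (- a) -> Fop H z a <= 0) ->
  lsubsol H O v.
Proof.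
move=> oO cv subv z0 Oz0 a0 [phi [G [gcG mx ->]]] {a0}.
have [_ cG] := nbhs_singleton gcG.
have gG : \forall y \near z0, gr phi y (G y) by apply: filterS gcG => y [].
have [M0 h1 h2] := HM.
rewrite leNgt; apply/negP => F0; pose eta := Fop H z0 (G z0) / 4.
have eta0 : 0 < eta by rewrite /eta; lra.
(* The gradient of [psi] below, whose extra [nsq] makes the maximum at [z0] strict and so confines
   [ze]. *)
pose G' y := G y + 2 *: (y - z0).
have cG' : {for z0, continuous G'}.
  exact: (cvgD cG (cvgZ (cvg_cst (2 : R)) (cvgB cvg_id (cvg_cst z0)))).
have nF : \forall y \near z0, 3 * eta < Fop H y (G' y).
  apply: (cvgr_gt _ (Fop_continuous HM cG')).
  by rewrite /G' subrr scaler0 addr0 /eta; lra.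
have M1 : 0 < M + 1 by rewrite ltr_wpDl.
(* [v] will oscillate by at most [2 * rho] on [N]; the part [7 * M * rho] of the final error is then
   below [eta / 2]. *)
pose rho := eta / (24 * (M + 1)).
have rho0 : 0 < rho by rewrite divr_gt0// mulr_gt0.
have near_v (c : R) : 0 < c -> \forall y \near z0, `|v z0 - v y| < c.
  by move=> c0; have /cvgrPdist_lt := cv z0 Oz0; exact.
have [r' r'0 Hr'] : exists2 r', 0 < r' & forall y, nsq (y - z0) < r' ->
    [/\ O y, gr phi y (G y), v y - phi y <= v z0 - phi z0,
        3 * eta < Fop H y (G' y) & `|v z0 - v y| < rho].
  apply/near_nsq; have nO : \forall y \near z0, O y by exact: open_nbhs_nbhs.
  apply: filterS2 (filterI nO gG) (filterI (filterI mx nF) (near_v _ rho0)).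
  by move=> y [? ?] [[? ?] ?].
pose r := r' / 2; have r0 : 0 < r by rewrite /r; lra.
pose N : set E := [set y | nsq (y - z0) <= r].
have HN y : N y -> [/\ O y, gr phi y (G y), v y - phi y <= v z0 - phi z0,
    3 * eta < Fop H y (G' y) & `|v z0 - v y| < rho].
  by move=> Ny; apply: Hr'; apply: le_lt_trans Ny _; rewrite /r; lra.
have Nz0 : N z0 by rewrite /N /= subrr nsq0 ltW.
have cN : compact N by exact: compact_cball.
have [r1 r10 Hr1] : exists2 r1, 0 < r1 & forall y, nsq (y - z0) < r1 ->
    `|v z0 - v y| < r / 4.
  by apply/near_nsq; apply: near_v; lra.
(* In turn: [v] differs by less than [r / 4] between [z0] and [Y z0]; the minimizer [y] found below
   is interior to [N]; the error [M * b] is at most [eta / 2]. *)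
pose eps := Num.min (r1 / (8 * rho)) (Num.min (r / (64 * rho))
   (eta ^+ 2 / (80 * (M ^+ 2 + 1) * rho))).
have M21 : 0 < M ^+ 2 + 1 by rewrite ltr_wpDl ?sqr_ge0.
have [d1 d2 d3] : [/\ 0 < 8 * rho, 0 < 64 * rho & 0 < 80 * (M ^+ 2 + 1) * rho].
  by split; rewrite mulr_gt0// mulr_gt0.
have eps0 : 0 < eps by rewrite !lt_min !divr_gt0// exprn_gt0.
have [eps1 eps2 eps3] : [/\ eps * (8 * rho) <= r1, eps * (64 * rho) <= r
   & eps * (80 * (M ^+ 2 + 1) * rho) <= eta ^+ 2].
  by split; rewrite -ler_pdivlMr// /eps !ge_min lexx ?orbT.
pose i2e := (2 * eps)^-1; have i2e0 : 0 < i2e by rewrite invr_gt0 mulr_gt0.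
have i2eE : i2e * (2 * eps) = 1 by rewrite mulVf// gt_eqF// mulr_gt0.
have vN : usc N (fun y => - v y).
  apply: usc_for => y /HN[Oy _ _ _ _]; exact: (cvgN (cv y Oy)).
have /choice[Y HY] : forall z, exists y, N y /\ forall y', N y' ->
    v y + i2e * nsq (z - y) <= v y' + i2e * nsq (z - y').
  move=> z; have cq : continuous (fun y => - (i2e * nsq (y - z))).
    move=> y; apply: cvgN; apply: cvgM; first exact: cvg_cst.
    exact: continuous_nsqB.
  have [y Ny Hy] := usc_max cN (ex_intro _ z0 Nz0) (uscD vN (continuous_usc (A := N) cq)).
  by exists y; split => // y' /Hy; rewrite (nsqB y) (nsqB y'); lra.
pose f z := v (Y z) + i2e * nsq (z - Y z).
have fv z : N z -> f z <= v z.
  by move=> Nz; have [_ /(_ z Nz)] := HY z; rewrite subrr nsq0 mulr0 addr0.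
have nY z : N z -> nsq (z - Y z) <= 4 * rho * eps.
  move=> Nz; have := fv z Nz; rewrite /f.
  have [NY _] := HY z; have [_ _ _ _] := HN _ NY; have [_ _ _ _] := HN _ Nz.
  rewrite !ltr_norml => /andP[a1 a2] /andP[a3 a4] fz.
  have : i2e * nsq (z - Y z) <= 2 * rho by lra.
  rewrite ler_pdivrMl ?mulr_gt0//; lra.
have uscf : usc N f.
  move=> z Nz c fc; have [NY _] := HY z.
  have cq : {for z, continuous (fun y => v (Y z) + i2e * nsq (y - Y z))}.
    apply: cvgD; first exact: cvg_cst.
    by apply: cvgM; [exact: cvg_cst|exact: continuous_nsqB].
  apply: filterS (cvgr_lt _ cq c fc) => y yc Ny.
  by apply: le_lt_trans yc; have [_ /(_ _ NY)] := HY y.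
pose psi y := phi y + nsq (y - z0).
have gpsi y : N y -> gr psi y (G' y).
  by move=> /HN[_ g _ _ _]; exact: grD g (gr_nsq z0 y).
have uscpsi : usc N (fun y => - psi y).
  by apply: usc_for => y Ny; exact: (cvgN (gr_continuous (gpsi y Ny))).
have [ze Nze Hze] := usc_max cN (ex_intro _ z0 Nz0) (uscD uscf uscpsi).
(* As [f <= v] and [v - phi] peaks at [z0], this squared distance is at most [v z0 - f z0]. *)
have zer : nsq (ze - z0) <= r / 4.
  have := Hze z0 Nz0; rewrite /psi subrr nsq0.
  have [_ _ mxe _ _] := HN _ Nze; have fze := fv _ Nze.
  have : v z0 - f z0 <= r / 4.
    have yz0 : nsq (Y z0 - z0) < r1 by rewrite nsqB; have := nY _ Nz0; lra.
    have := Hr1 _ yz0; rewrite ltr_norml => /andP[_ ?].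
    have := mulr_ge0 (ltW i2e0) (nsq_ge0 (z0 - Y z0)); rewrite /f; lra.
  lra.
have [_ _ _ Fze _] := HN _ Nze; set xi := G' ze in Fze.
have [q Hq] := @approx_subgradient (H ze.2) (M * (1 + enorm ze.2)) xi.2 eta
  (Hconv ze.2) (mulr_ge0 M0 (addr_ge0 ler01 (enorm_ge0 _))) (h1 ze.2) eta0.
pose e : E := (1, q); pose ne := nsq e; have ne0 : 0 <= ne by exact: nsq_ge0.
have eta20 : 0 < eta / 2 by lra.
have [s1 s10 Hs1] := gr_dir (- e) (gpsi _ Nze) eta20.
have nearz0 : \forall y \near ze, nsq (y - z0) < 3 / 8 * r.
  by apply: (cvgr_lt _ (@continuous_nsqB _ _ z0 ze)); lra.
have [s2 s20 Hs2] := near_line (- e) nearz0.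
(* The last two bounds make the quadratic remainder [i2e * (h * ne)] at most [eta / 2] and keep
   [nsq (ze - z)] of order [rho * eps], like the bound on [nsq (z - y)]. *)
have [h [h0 hs1 hs2 hne hne2]] : exists h, [/\ 0 < h, h < s1, h < s2,
    h * ne <= eta * eps & h ^+ 2 * ne <= rho * eps].
  have ne1 : 0 < ne + 1 by rewrite ltr_wpDl.
  pose m := Num.min (Num.min s1 s2) (Num.min 1 (Num.min (eta * eps / (ne + 1))
    (rho * eps / (ne + 1)))).
  have m0 : 0 < m by rewrite !lt_min s10 s20 ltr01 !divr_gt0// mulr_gt0.
  have hm : m / 2 < m by lra.
  have h'0 : 0 < m / 2 by lra.
  set h' := m / 2 in hm h'0; move: hm.
  rewrite /m !lt_min => /andP[/andP[a1 a2] /and3P[a3]].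
  rewrite !ltr_pdivlMr// => a4 a5; exists h'; split => //.
    by move: a4 h'0; clear; lra.
  have : h' * (h' * ne) <= h' * ne.
    by rewrite ler_piMl ?(ltW a3)// mulr_ge0// ltW.
  by move: a5 h'0; clear; lra.
pose z := ze + h *: - e; pose y := Y z.
have zr := Hs2 h h0 hs2; rewrite -/z in zr.
have Nz : N z by rewrite /N /=; lra.
have zy := nY z Nz; rewrite -/y in zy.
have yr : nsq (y - z0) < r.
  by have := nsq_tri y z0 z; rewrite (nsqB y z); lra.
pose ze' := i2e *: (2 *: (z - y)).
have [Ny Hy] := HY z; rewrite -/y in Ny Hy.
have [Oy _ _ _ _] := HN _ Ny.
have Fy : Fop H y ze' <= 0.
  apply: subv => //; exists (fun w => i2e * nsq (w - z)), (fun w => i2e *: (2 *: (w - z))).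
  split; first exact: (C1gZ i2e (C1g_nsq z)).
    have : \forall w \near y, N w.
      apply: filterS (cvgr_lt _ (@continuous_nsqB _ _ z0 y) r yr) => w; exact: ltW.
    by apply: filterS => w /Hy; rewrite (nsqB w) (nsqB y); lra.
  by rewrite /ze' -!scalerN opprB.
(* The same [y] competes in the infimum at [ze], so [f ze - f z] is at most the change of one
   paraboloid; maximality of [f - psi] bounds it below by the change of [psi]. *)
have dir : sdot xi e - eta <= sdot ze' e.
  have := Hs1 h h0 hs1; rewrite -/z sdotNr ler_norml => /andP[_ p1].
  have p2 := Hze z Nz.
  have p3 : f ze <= v y + i2e * nsq (ze - y) by have [_ /(_ _ Ny)] := HY ze.
  have p4 : f z = v y + i2e * nsq (z - y) by [].
  have p5 : nsq (ze - y) = nsq (z - y) + h * (2 * sdot (z - y) e) + h ^+ 2 * ne.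
    have -> : ze - y = (z - y) + h *: e.
      by rewrite /z scalerN addrAC subrK.
    exact: nsqDZ.
  have p6 : sdot ze' e = i2e * (2 * sdot (z - y) e) by rewrite /ze' !sdotZl.
  have p7 : i2e * (h * ne) <= eta / 2.
    by rewrite ler_pdivrMl ?mulr_gt0//; lra.
  have : h * (sdot xi e - eta) <= h * sdot ze' e.
    rewrite p6; have p8 : h * (i2e * (h * ne)) <= h * (eta / 2) by rewrite (ler_pM2l h0).
    by move: p1 p2 p3 p4 p8; rewrite p5; clear; lra.
  by rewrite ler_pM2l.
have Hze' := Hq ze'.2.
have e1 := h2 ze.2 y.2 ze'.2.
pose b := enorm (ze.2 - y.2).
have b0 : 0 <= b by exact: enorm_ge0.
have zey : nsq (ze - y) <= 10 * (rho * eps).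
  have := nsq_tri ze y z; have -> : ze - z = h *: e.
    by rewrite /z opprD addrA subrr sub0r scalerN opprK.
  by rewrite nsqZ -/ne; lra.
have b2 : b ^+ 2 <= 10 * (rho * eps).
  by apply: le_trans zey; exact: (nsq_snd (ze - y)).
pose c := enorm (z.2 - y.2).
have c2 : c ^+ 2 <= 4 * rho * eps by apply: le_trans zy; exact: (nsq_snd (z - y)).
have ec : enorm ze'.2 = i2e * (2 * c) by rewrite /ze' /= !enormZ !gtr0_norm.
have Mb : M * b <= eta / 2.
  rewrite -(@ler_pXn2r _ 2) ?nnegrE ?mulr_ge0//; last exact: ltW.
  have : M ^+ 2 * b ^+ 2 <= M ^+ 2 * (10 * (rho * eps)) by rewrite ler_wpM2l ?sqr_ge0.
  rewrite exprMn; have := mulr_gt0 rho0 eps0.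
  by move: eps3; clear; nra.
(* The spatial part of [ze'] has size [c / eps], but it multiplies [b], and both [b ^+ 2] and
   [c ^+ 2] are of order [rho * eps]. *)
have cb : i2e * (2 * c) * b <= 7 * rho.
  have : i2e * (2 * (c * b)) <= i2e * (14 * (rho * eps)).
    rewrite ler_wpM2l ?(ltW i2e0)//; have := sqr_ge0 (c - b).
    by move: b2 c2; clear; lra.
  have -> : i2e * (14 * (rho * eps)) = 7 * rho * (i2e * (2 * eps)) by ring.
  by rewrite i2eE; clear; lra.
have err : M * (1 + enorm ze'.2) * b < eta.
  rewrite ec; have : M * (i2e * (2 * c) * b) <= M * (7 * rho) by rewrite ler_wpM2l.
  have : rho * (24 * (M + 1)) = eta by rewrite /rho divfK// gt_eqF// mulr_gt0.
  by move: Mb rho0 eta0; clear; lra.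
have Fze' : 3 * eta < xi.1 + H ze.2 xi.2 by exact: Fze.
have Fy' : ze'.1 + H y.2 ze'.2 <= 0 by exact: Fy.
have dir' : xi.1 + dotv xi.2 q - eta <= ze'.1 + dotv ze'.2 q.
  by have := dir; rewrite /sdot /= !mulr1.
have Hze2 : H ze.2 xi.2 + (dotv ze'.2 q - dotv xi.2 q) - eta <= H ze.2 ze'.2.
  by have := Hze'; rewrite dotvDr dotvNr !(dotvC q).
move: e1; rewrite ler_norml -/b => /andP[_ e1].
(* Adding [dir'] and [Hze2] cancels the terms in [q]; the total error stays below [3 * eta], against
   [Fze']. *)
by move: e1 err Hze2 dir' Fy' Fze' eta0; clear; lra.
Qed.

End BarronJensen.

(** * Existence by Perron's method *)

Section Envelope.
Set Implicit Arguments.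
Unset Strict Implicit.
Variables (R : realType) (n : nat).
Local Notation E := (spt R n).
Variables (A : set E) (f : E -> R).
Implicit Types (z y : E).

(** The upper semicontinuous envelope relative to [A]; [bnd] makes the infimum meaningful. *)
Definition usce z : R := inf [set c | \forall y \near z, A y -> f y <= c].

Hypothesis bnd : forall z, A z -> exists c, \forall y \near z, A y -> f y <= c.

Lemma usce_has_inf z :
  A z -> has_inf [set c | \forall y \near z, A y -> f y <= c].
Proof.
move=> Az; split; first by have [c] := bnd Az; exists c.
by exists (f z) => c /nbhs_singleton; exact.
Qed.

Lemma usce_ge z : A z -> f z <= usce z.
Proof.
move=> Az; apply: lb_le_inf; first by have [] := usce_has_inf Az.
by move=> c /nbhs_singleton; exact.
Qed.

Lemma usce_usc : usc A usce.
Proof.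
move=> z Az c /(inf_lt (usce_has_inf Az).1)[c0 /= /near_nsq[r r0 Hr] c0c].
apply/near_nsq; exists r => // y yr Ay; apply: le_lt_trans c0c.
apply: inf_lbound; first by have [] := usce_has_inf Ay.
have nr : \forall w \near y, nsq (w - z) < r.
  exact: (cvgr_lt _ (@continuous_nsqB _ _ z y)).
by apply: filterS nr => w; exact: Hr.
Qed.

Lemma usce_approx z c r : A z -> c < usce z -> 0 < r ->
  exists y, [/\ nsq (y - z) < r, A y & c < f y].
Proof.
move=> Az cu r0; apply: contrapT => no.
suff : usce z <= c by rewrite leNgt cu.
apply: inf_lbound; first by have [] := usce_has_inf Az.
apply/near_nsq; exists r => // y yr Ay; rewrite leNgt; apply/negP => cf.
by apply: no; exists y.
Qed.

Lemma usce_le (m : E -> R) z : A z -> {for z, continuous m} ->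
  (forall y, A y -> f y <= m y) -> usce z <= m z.
Proof.
move=> Az cm fm; rewrite leNgt; apply/negP => mu.
pose c := (m z + usce z) / 2.
have mc : m z < c by rewrite /c; lra.
have cu : c < usce z by rewrite /c; lra.
have /near_nsq[r r0 Hr] : \forall y \near z, m y < c by exact: (cvgr_lt (m z) cm).
have [y [yr Ay cf]] := usce_approx Az cu r0.
by have := Hr y yr; have := fm y Ay; lra.
Qed.

End Envelope.

(** * Barriers and the supremum of subsolutions on a region *)

Section Perron.
Set Implicit Arguments.
Unset Strict Implicit.
Variables (R : realType) (n : nat).
Local Notation E := (spt R n).
Local Notation V := (vec R n).
Variables (M delta T : R).
Hypothesis delta0 : 0 < delta.
Implicit Types (H : V -> V -> R) (g : V -> R) (z y : E).
Local Notation D0 := (@region0 R n M delta T).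
Local Notation D := (@region R n M delta T).

Lemma region0_fst z : 0 <= M -> D0 z -> D0 (0, z.2).
Proof.
move=> M0 [z0 zT]; split => //; apply: le_lt_trans zT.
rewrite /cone /= mulr0 expR0 mul1r add0r.
rewrite -[leLHS]add0r lerD// ler_wpM2l ?(ltW delta0)//.
rewrite ler_peMl ?addr_ge0 ?dotv_ge0//.
by rewrite -expR0 ler_expR !mulr_ge0.
Qed.

(** A paraboloid around [x0] plus [K] times time: steep enough to dominate [g] on the initial face,
    then [K] large enough for a classical supersolution. Applied to [negH H] and [- g], it also
    yields barriers from below. *)
Lemma barrier H g x0 e : Hlip M H -> continuous g -> 0 < e -> D0 (0, x0) ->
  exists f G, [/\ C1g f G, forall z, D0 z -> 0 <= Fop H z (G z),
    forall x, D0 (0, x) -> g x <= f (0, x) & f (0, x0) <= g x0 + e].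
Proof.
move=> HM cg e0 D0x.
pose C : set E := [set y | 0 <= y.1 /\ cone M delta y <= T].
have cC : compact C by exact: (compact_cone HM).
have D0C : D0 `<=` C by move=> y [? ?]; split => //; exact: ltW.
pose z0 : E := (0, x0).
have C0 : C !=set0 by exists z0; exact: D0C.
have cgs : continuous (fun y : E => g y.2).
  by move=> y; apply: (@for_comp _ _ _ snd g); [exact: cvg_snd|exact: cg].
have [r r0 Hr] : exists2 r, 0 < r & forall y, nsq (y - z0) < r -> g y.2 < g x0 + e.
  by apply/near_nsq; apply: (cvgr_lt _ (cgs z0)); rewrite /=; lra.
have [b _ Hb] := usc_max cC C0 (continuous_usc (A := C) cgs).
(* Beyond squared distance [r] the paraboloid is at least [L * r], which covers the excess of the
   maximum of [g] over [g x0]. *)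
pose L := `|g b.2 - g x0| / r.
have L0 : 0 <= L by rewrite divr_ge0// ltW.
pose G1 y : E := L *: (2 *: (y - z0)).
have cG1 : continuous G1.
  by move=> y; have [_ c] := C1gZ L (C1g_nsq z0); exact: c.
have cF : continuous (fun y => - Fop H y (G1 y)).
  move=> y; have c : {for y, continuous (fun y => Fop H y (G1 y))}.
    exact: (Fop_continuous HM (cG1 y)).
  exact: (cvgN c).
have [k _ Hk] := usc_max cC C0 (continuous_usc (A := C) cF).
pose K := - Fop H k (G1 k).
have CF := C1gD (C1g_cst n (g x0 + e))
  (C1gD (C1gZ L (C1g_nsq z0)) (C1gZ K (C1g_fst R n))).
eexists _, _; split; first exact: CF.
- move=> z /D0C Cz; have := Hk z Cz; rewrite -/K.
  have -> : 0 + (L *: (2 *: (z - z0)) + K *: ((1, 0) : E)) = ((G1 z).1 + K, (G1 z).2).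
    rewrite add0r; apply/pair_equal_spec; split; last by rewrite /= scaler0 addr0.
    by rewrite /= /GRing.scale /= mulr1.
  rewrite -[Fop H z (G1 z)]/((G1 z).1 + H z.2 (G1 z).2).
  rewrite -[Fop H z _]/((G1 z).1 + K + H z.2 (G1 z).2).
  by lra.
- move=> x /D0C Cx; rewrite /= mulr0 addr0.
  have [xr|xr] := ltP (nsq (((0, x) : E) - z0)) r.
    have := Hr _ xr; have := mulr_ge0 L0 (nsq_ge0 (((0, x) : E) - z0)).
    by rewrite /=; lra.
  have := Hb _ Cx; have : L * r <= L * nsq (((0, x) : E) - z0) by rewrite ler_wpM2l.
  rewrite /L divfK ?gt_eqF//; have := ler_norm (g b.2 - g x0); rewrite /=; lra.
- by rewrite /= subrr nsq0 !mulr0 !addr0.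
Qed.

Lemma classical_subsol H f G : C1g f G ->
  (forall z, D0 z -> 0 <= Fop H z (G z)) -> lsubsol (negH H) D (fun y => - f y).
Proof.
move=> [gf _] F0 z Dz a la.
rewrite -(lsup_gr (grN (gf z)) la) Fop_neg oppr_le0.
by apply: F0; exact: region_sub0.
Qed.

Definition perron_class H g (s : E -> R) : Prop :=
  [/\ usc D0 s, lsubsol H D s & forall x, D0 (0, x) -> s (0, x) <= g x].

Lemma perron_barrier H g s f G : Hlip M H -> perron_class H g s -> C1g f G ->
  (forall z, D0 z -> 0 <= Fop H z (G z)) ->
  (forall x, D0 (0, x) -> g x <= f (0, x)) ->
  forall z, D0 z -> s z <= f z.
Proof.
move=> HM [us ss ini] Cf Ff gf z Dz; rewrite -subr_le0.
have cf : continuous (fun y => - f y) by exact: C1g_continuous (C1gN Cf).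
apply: (comparison_region HM delta0 us (continuous_usc cf) (lsubsol_gsubsol ss)
  (lsubsol_gsubsol (classical_subsol Cf Ff))) Dz => x Dx.
by rewrite subr_le0; exact: le_trans (ini x Dx) (gf x Dx).
Qed.

Lemma perron_lower H g x0 e : Hlip M H -> continuous g -> 0 < e -> D0 (0, x0) ->
  exists s, [/\ perron_class H g s, continuous s & g x0 - e <= s (0, x0)].
Proof.
move=> HM cg e0 Dx; have cNg : continuous (fun x => - g x).
  by move=> x; exact: (cvgN (cg x)).
have [f [G [Cf Ff gf fx]]] := barrier (Hlip_neg HM) cNg e0 Dx.
have cf : continuous (fun y => - f y) by exact: C1g_continuous (C1gN Cf).
exists (fun y => - f y); split => //; last by lra.
split; first exact: continuous_usc.
  by rewrite -(negHK H); exact: classical_subsol Cf Ff.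
by move=> x /gf; lra.
Qed.

Definition perron_sup H g z : R := sup [set s z | s in perron_class H g].

Section Construction.
Variables (H : V -> V -> R) (g : V -> R).
Hypothesis HM : Hlip M H.
Hypothesis cg : continuous g.
Let M0 : 0 <= M. Proof. by case: HM. Qed.
Local Notation u := (perron_sup H g).
Local Notation U := (usce D0 u).

Lemma perron_has_sup z : D0 z -> has_sup [set s z | s in perron_class H g].
Proof.
move=> Dz; have Dx := region0_fst M0 Dz; split.
  by have [s [Fs _ _]] := perron_lower HM cg ltr01 Dx; exists (s z), s.
have [f [G [Cf Ff gf _]]] := barrier HM cg ltr01 Dx.
by exists (f z) => _ [s Fs <-]; exact: (perron_barrier HM Fs Cf Ff gf Dz).
Qed.

Lemma perron_sup_ge s z : perron_class H g s -> D0 z -> s z <= u z.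
Proof.
move=> Fs Dz; apply: sup_upper_bound; first exact: perron_has_sup.
by exists s.
Qed.

Lemma perron_sup_le f G z : C1g f G -> (forall z, D0 z -> 0 <= Fop H z (G z)) ->
  (forall x, D0 (0, x) -> g x <= f (0, x)) -> D0 z -> u z <= f z.
Proof.
move=> Cf Ff gf Dz; apply: sup_le_ub; first by have [] := perron_has_sup Dz.
by move=> _ [s Fs <-]; exact: (perron_barrier HM Fs Cf Ff gf Dz).
Qed.

Lemma near_bounded (f m : E -> R) z : continuous m -> (forall y, D0 y -> f y <= m y) ->
  exists c, \forall y \near z, D0 y -> f y <= c.
Proof.
move=> cm fm; exists (m z + 1).
have h : m z < m z + 1 by lra.
by apply: filterS (cvgr_lt (m z) (cm z) _ h) => y my /fm; lra.
Qed.

Lemma perron_sup_bounded z : D0 z -> exists c, \forall y \near z, D0 y -> u y <= c.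
Proof.
move=> Dz; have [f [G [Cf Ff gf _]]] := barrier HM cg ltr01 (region0_fst M0 Dz).
apply: (@near_bounded u f); first exact: C1g_continuous Cf.
by move=> y; exact: (perron_sup_le Cf Ff gf).
Qed.

Lemma perron_ge s z : perron_class H g s -> D0 z -> s z <= U z.
Proof.
move=> Fs Dz; apply: le_trans (perron_sup_ge Fs Dz) _.
exact: usce_ge perron_sup_bounded _ Dz.
Qed.

Lemma perron_init x : D0 (0, x) -> U (0, x) <= g x.
Proof.
move=> Dx; rewrite leNgt; apply/negP => gU.
pose e := (U (0, x) - g x) / 2; have e0 : 0 < e by rewrite /e; lra.
have [f [G [Cf Ff gf fx]]] := barrier HM cg e0 Dx.
have : U (0, x) <= f (0, x).
  apply: (usce_le perron_sup_bounded Dx).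
    exact: C1g_continuous Cf _.
  by move=> y; exact: (perron_sup_le Cf Ff gf).
by move: fx gU; rewrite /e; lra.
Qed.

(** If the inequality failed at [z], it would fail near [z] for [psi], a perturbation of [phi] with
    a strict maximum. A member [s] of the class nearly reaching [U z] has a maximum of [s - psi]
    near [z] and violates its own inequality there. *)
Lemma perron_subsol : lsubsol H D U.
Proof.
move=> z Dz a [phi [G [gG mx ->]]] {a}.
rewrite leNgt; apply/negP => F0.
pose G' y := G y + 2 *: (y - z).
have cG'z y : {for y, continuous G} -> {for y, continuous G'}.
  by move=> c; exact: (cvgD c (cvgZ (cvg_cst (2 : R)) (cvgB cvg_id (cvg_cst z)))).
have [gz cGz] := nbhs_singleton gG.
have nF : \forall y \near z, 0 < Fop H y (G' y).
  apply: (cvgr_gt _ (Fop_continuous HM (cG'z _ cGz))).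
  by rewrite /G' subrr scaler0 addr0.
have [r' r'0 Hr'] : exists2 r', 0 < r' & forall y, nsq (y - z) < r' ->
    [/\ D y, gr phi y (G y), {for y, continuous G}, U y - phi y <= U z - phi z &
        0 < Fop H y (G' y)].
  apply/near_nsq.
  apply: filterS2 (filterI (near_region Dz) gG) (filterI mx nF).
  by move=> y [? [? ?]] [? ?].
pose r := r' / 2; have r0 : 0 < r by rewrite /r; lra.
have rr' : r < r' by rewrite /r; lra.
pose N : set E := [set y | nsq (y - z) <= r].
have HN y : N y -> nsq (y - z) < r' by move=> Ny; exact: le_lt_trans Ny rr'.
have [r2 r20 Hr2] : exists2 r2, 0 < r2 & forall y, nsq (y - z) < r2 ->
    phi y < phi z + r / 4.
  by apply/near_nsq; apply: (cvgr_lt _ (gr_continuous gz)); lra.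
have Uc : U z - r / 4 < U z by lra.
have m0 : 0 < Num.min r2 (r / 4) by rewrite lt_min r20; lra.
have D0z : D0 z by exact: region_sub0.
(* The losses in [U], [phi] and [nsq] are each below [r / 4], so the maximum point [zt] is interior
   to [N]. *)
have [y0 [y0r Dy0 Uy0]] := usce_approx perron_sup_bounded D0z Uc m0.
move: y0r; rewrite lt_min => /andP[y0r2 y0r].
have [_ [s Fs <-] sy0] := sup_gt (perron_has_sup Dy0).1 Uy0.
have [us ss _] := Fs.
pose psi y := phi y + nsq (y - z).
have gpsi y : nsq (y - z) < r' -> gr psi y (G' y).
  by move=> /Hr'[_ g' _ _ _]; exact: grD g' (gr_nsq z y).
have uN : usc N (fun y => s y + - psi y).
  apply: uscD.
    by apply: uscS us => y /HN/Hr'[? _ _ _ _]; exact: region_sub0.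
  by apply: usc_for => y /HN Ny; exact: (cvgN (gr_continuous (gpsi y Ny))).
have N0 : N !=set0 by exists z; rewrite /N /= subrr nsq0 ltW.
have [zt Nzt Hzt] := usc_max (compact_cball (z := z) (r := r)) N0 uN.
have ztr : nsq (zt - z) < r.
  have := Hzt y0; rewrite /N /= => /(_ ltac:(lra)).
  have [Dzt _ _ mxt _] := Hr' _ (HN _ Nzt).
  have := perron_ge Fs (region_sub0 Dzt); have := Hr2 _ y0r2.
  by rewrite /psi; lra.
have [Dzt _ _ _ Fzt] := Hr' _ (HN _ Nzt).
have nN : \forall y \near zt, nsq (y - z) < r.
  exact: (cvgr_lt _ (@continuous_nsqB _ _ z zt)).
suff : lsup s zt (G' zt) by move=> /(ss _ Dzt); lra.
exists psi, G'; split => //.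
  apply: filterS nN => y yr; have yr' := lt_trans yr rr'.
  by split; [exact: gpsi|apply: cG'z; have [] := Hr' _ yr'].
by apply: filterS nN => y yr; apply: Hzt; exact: ltW.
Qed.

Lemma perron_class_usce : perron_class H g U.
Proof.
split; [exact: usce_usc perron_sup_bounded|exact: perron_subsol|].
exact: perron_init.
Qed.

Local Notation L := (usce D0 (fun y => - U y)).

Lemma perron_neg_bounded z :
  D0 z -> exists c, \forall y \near z, D0 y -> - U y <= c.
Proof.
move=> Dz.
have [s [Fs cs _]] := perron_lower HM cg ltr01 (region0_fst M0 Dz).
apply: (@near_bounded _ (fun y => - s y)); first by move=> y; exact: (cvgN (cs y)).
by move=> y Dy; rewrite lerN2; exact: perron_ge.
Qed.

(* Otherwise raising [U] near [z] to the test function [w] would give a member of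
   [perron_class] exceeding [U] somewhere. *)
Lemma perron_supersol : lsubsol (negH H) D L.
Proof.
move=> z Dz a [phi [G [gG mx ->]]] {a}.
rewrite leNgt; apply/negP => F0.
pose G' y := G y + 2 *: (y - z).
have cG'z y : {for y, continuous G} -> {for y, continuous G'}.
  by move=> c; exact: (cvgD c (cvgZ (cvg_cst (2 : R)) (cvgB cvg_id (cvg_cst z)))).
have [gz cGz] := nbhs_singleton gG.
have nF : \forall y \near z, 0 < Fop (negH H) y (G' y).
  apply: (cvgr_gt _ (Fop_continuous (Hlip_neg HM) (cG'z _ cGz))).
  by rewrite /G' subrr scaler0 addr0.
have [r' r'0 Hr'] : exists2 r', 0 < r' & forall y, nsq (y - z) < r' ->
    [/\ D y, gr phi y (G y), L y - phi y <= L z - phi z &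
        0 < Fop (negH H) y (G' y)].
  apply/near_nsq.
  apply: filterS2 (filterI (near_region Dz) gG) (filterI mx nF).
  by move=> y [? [? ?]] [? ?].
pose r := r' / 2; have r0 : 0 < r by rewrite /r; lra.
have rr' : r < r' by rewrite /r; lra.
pose psi y := phi y + nsq (y - z).
have gpsi y : nsq (y - z) < r' -> gr psi y (G' y).
  by move=> /Hr'[_ g' _ _]; exact: grD g' (gr_nsq z y).
(* [w z] exceeds [- L z] by [r / 2], an excess absorbed by [nsq] once this reaches [r / 2]. Hence
   [w <= U] between [r / 2] and [r], and the two clauses of [s] below agree there. *)
pose w y := (phi z - L z + r / 2) - psi y.
have gw y : nsq (y - z) < r' -> gr w y (- G' y).
  move=> /gpsi g'; have := grD (gr_cst (phi z - L z + r / 2) y) (grN g').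
  by rewrite add0r.
have wU y : nsq (y - z) < r' -> r / 2 <= nsq (y - z) -> w y <= U y.
  move=> yr' yr; have [Dy _ mxy _] := Hr' _ yr'.
  have := usce_ge perron_neg_bounded (region_sub0 Dy).
  by rewrite /w /psi; lra.
pose s y := if nsq (y - z) <= r then Num.max (U y) (w y) else U y.
have s1 y : nsq (y - z) < r -> \forall y' \near y, s y' = Num.max (U y') (w y').
  move=> yr; apply: filterS (cvgr_lt _ (@continuous_nsqB _ _ z y) r yr) => y' yr'.
  by rewrite /s (ltW yr').
have s2 y : r <= nsq (y - z) -> \forall y' \near y, s y' = U y'.
  move=> yr; have ryr : r / 2 < nsq (y - z) by lra.
  apply: filterS (cvgr_gt _ (@continuous_nsqB _ _ z y) _ ryr) => y' yr'.
  rewrite /s; case: ifP => // y'r; apply: max_l; apply: wU; last exact: ltW.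
  exact: le_lt_trans rr'.
have [uU sU iU] := perron_class_usce.
have Fs : perron_class H g s.
  split.
  - move=> y Dy c; have [yr|yr] := ltP (nsq (y - z)) r.
      have yr' := lt_trans yr rr'.
      rewrite (nbhs_singleton (s1 _ yr)) gt_max => /andP[Uc wc].
      have nw : \forall t \near y, w t < c.
        exact: (cvgr_lt _ (gr_continuous (gw _ yr')) c wc).
      apply: filterS2 (s1 _ yr) (filterI (uU y Dy c Uc) nw) => y' -> [Uc' wc'] Dy'.
      by rewrite gt_max wc' andbT; exact: Uc'.
    rewrite (nbhs_singleton (s2 _ yr)) => Uc.
    by apply: filterS2 (s2 _ yr) (uU y Dy c Uc) => y' ->.
  - move=> y Dy a; have [yr|yr] := ltP (nsq (y - z)) r; last first.
      move=> la; apply: (sU y Dy); apply: lsup_le la.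
        by apply: filterS (s2 _ yr) => y' ->.
      by rewrite (nbhs_singleton (s2 _ yr)).
    have yr' := lt_trans yr rr'; have sy := nbhs_singleton (s1 _ yr).
    have [Uw|wU'] := leP (w y) (U y).
      move=> la; apply: (sU y Dy); apply: lsup_le la.
        by apply: filterS (s1 _ yr) => y' ->; rewrite le_max lexx.
      by rewrite sy; apply/esym/max_l.
    move=> la; have lw : lsup w y a.
      apply: lsup_le la.
        by apply: filterS (s1 _ yr) => y' ->; rewrite le_max lexx orbT.
      by rewrite sy; apply/esym/max_r/ltW.
    rewrite -(lsup_gr (gw _ yr') lw); have [_ _ _ Fy] := Hr' _ yr'.
    by rewrite -[H]negHK Fop_neg oppr_le0 ltW.
  (* The ball lies in [D], where time is positive, so [s] is [U] on the initial face. *)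
  - move=> x Dx; have xr : r <= nsq (((0, x) : E) - z).
      rewrite leNgt; apply/negP => xr; have := Hr' _ (lt_trans xr rr').
      by move=> [[/=]]; rewrite ltxx.
    by rewrite (nbhs_singleton (s2 _ xr)); exact: iU.
(* Where [- U] nearly attains [L z], three losses of [r / 8] still leave [w] above [U]. *)
have Lc : L z - r / 8 < L z by lra.
have r80 : 0 < r / 8 by lra.
have [r2 r20 Hr2] : exists2 r2, 0 < r2 & forall y, nsq (y - z) < r2 ->
    phi y < phi z + r / 8.
  by apply/near_nsq; apply: (cvgr_lt _ (gr_continuous gz)); lra.
have m0 : 0 < Num.min r2 (r / 8) by rewrite lt_min r20.
have [y [yr Dy Uy]] := usce_approx perron_neg_bounded (region_sub0 Dz) Lc m0.
move: yr; rewrite lt_min => /andP[yr2 yr].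
have := perron_ge Fs Dy; have yrr : nsq (y - z) <= r by lra.
rewrite /s yrr ge_max => /andP[_]; have := Hr2 _ yr2.
by rewrite /w /psi; lra.
Qed.

(** [- L] is the lower envelope of [U]. Comparison of the two gives [U <= - L], the reverse of the
    trivial inequality, so [U] is continuous on the region. *)
Lemma perron_solution : exists f : E -> R,
  [/\ usc D0 f, usc D0 (fun y => - f y), lsubsol H D f,
     lsubsol (negH H) D (fun y => - f y) & forall x, D0 (0, x) -> f (0, x) = g x].
Proof.
have [uU sU iU] := perron_class_usce.
have uL : usc D0 L by exact: usce_usc perron_neg_bounded.
have iL x : D0 (0, x) -> L (0, x) <= - g x.
  move=> Dx; rewrite leNgt; apply/negP => gL.
  pose e := (L (0, x) + g x) / 2; have e0 : 0 < e by rewrite /e; lra.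
  have [s [Fs cs sx]] := perron_lower HM cg e0 Dx.
  have : L (0, x) <= - s (0, x).
    apply: (usce_le perron_neg_bounded Dx (m := fun y => - s y)).
      exact: (cvgN (cs _)).
    by move=> y Dy; rewrite lerN2; exact: perron_ge.
  by move: sx gL; rewrite /e; lra.
have UL z : D0 z -> U z + L z <= 0.
  apply: (comparison_region HM delta0 uU uL (lsubsol_gsubsol sU)
    (lsubsol_gsubsol perron_supersol)) => x Dx.
  by have := iU x Dx; have := iL x Dx; lra.
have LU z : D0 z -> - U z <= L z by move=> Dz; exact: (usce_ge perron_neg_bounded Dz).
have LE z : D0 z -> L z = - U z.
  by move=> Dz; apply/eqP; rewrite eq_le LU// andbT; have := UL z Dz; lra.
exists U; split => //.
- move=> z Dz c Uc; have Lc : L z < c by rewrite LE.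
  by apply: filterS (uL z Dz c Lc) => y + Dy; rewrite LE//; exact.
- move=> z Dz a la; apply: (perron_supersol Dz); apply: lsup_le la.
    by apply: filterS (near_region Dz) => y Dy; rewrite LE//; exact: region_sub0.
  by rewrite LE//; exact: region_sub0.
- move=> x Dx; apply/eqP; rewrite eq_le iU//=.
  by have := iL x Dx; rewrite LE//; lra.
Qed.

End Construction.

End Perron.

(** * Solutions on the strip and time reversal *)

Section Strip.
Set Implicit Arguments.
Unset Strict Implicit.
Variables (R : realType) (n : nat).
Local Notation E := (spt R n).
Local Notation V := (vec R n).
Implicit Types (H : V -> V -> R) (u v w : E -> R) (z y : E).

Lemma within_continuousP (X : topologicalType) (A : set X) (u : X -> R) :
  {within A, continuous u} <->
  forall z : X, A z -> forall e, 0 < e -> \forall y \near z, A y -> `|u z - u y| < e.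
Proof.
split=> [/subspace_continuousP cu z Az e e0|cu].
  by have /cvgrPdist_lt /(_ e e0) := cu z Az; rewrite near_withinE.
apply/subspace_continuousP => z Az; apply/cvgrPdist_lt => e e0.
by rewrite near_withinE; exact: cu.
Qed.

Lemma within_uscP (X : topologicalType) (A : set X) (u : X -> R) :
  {within A, continuous u} <-> usc A u /\ usc A (fun y : X => - u y).
Proof.
split=> [/within_continuousP cu|[uu Nu]].
  split=> z Az c uc.
    have /(cu z Az) : 0 < c - u z by lra.
    by apply: filterS => y + Ay => /(_ Ay); rewrite ltr_norml; lra.
  have /(cu z Az) : 0 < c + u z by lra.
  by apply: filterS => y + Ay => /(_ Ay); rewrite ltr_norml; lra.
apply/within_continuousP => z Az e e0.
have uc : u z < u z + e by lra.
have Nc : - u z < - u z + e by lra.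
apply: filterS2 (uu z Az _ uc) (Nu z Az _ Nc) => y + + Ay.
by move=> /(_ Ay) a1 /(_ Ay) a2; rewrite ltr_norml; lra.
Qed.

Lemma near_strip_closed T z : strip_open T z -> \forall y \near z, strip_closed T y.
Proof.
move=> Oz; apply: filterS (open_nbhs_nbhs (conj (@open_strip _ _ T) Oz)) => y.
by rewrite /strip_open /strip_closed /= => /andP[? ?]; apply/andP; split; exact: ltW.
Qed.

Lemma strip_open_closed T z : strip_open T z -> @strip_closed R n T z.
Proof. by move=> /near_strip_closed/nbhs_singleton. Qed.

Lemma within_strip_for T u z :
  {within strip_closed T, continuous u} -> strip_open T z -> {for z, continuous u}.
Proof.
move=> /within_continuousP cu Oz; apply/cvgrPdist_lt => e e0.
apply: filterS2 (near_strip_closed Oz) (cu z (strip_open_closed Oz) e e0) => y Cy.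
exact.
Qed.

Lemma within_strip_rev T u : {within strip_closed T, continuous u} ->
  {within strip_closed T, continuous (u \o trev T)}.
Proof.
move=> /within_continuousP cu; apply/within_continuousP => z Cz e e0.
have : \forall y \near z, strip_closed T (trev T y) ->
    `|u (trev T z) - u (trev T y)| < e.
  exact: (@rev_continuous _ _ T z _ (cu _ (strip_closed_rev Cz) e e0)).
by apply: filterS => y h /strip_closed_rev/h.
Qed.

Lemma continuous_slice T u (t : R) : {within strip_closed T, continuous u} ->
  0 <= t <= T -> continuous (fun x : V => u (t, x)).
Proof.
move=> /within_continuousP cu tT x.
have Cx (x' : V) : strip_closed T ((t, x') : E) by [].
have ci : {for x, continuous (fun x' : V => (t, x') : E)}.
  apply: (@for_pair _ _ _ (fun _ : V => t) (fun x' : V => x') x).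
    exact: cst_continuous.
  exact: cvg_id.
have h e : 0 < e -> \forall x' \near x, `|u (t, x) - u (t, x')| < e.
  move=> e0; have : \forall x' \near x, strip_closed T ((t, x') : E) ->
      `|u (t, x) - u (t, x')| < e by exact: (ci _ (cu _ (Cx x) e e0)).
  by apply: filterS => x' /(_ (Cx x')).
by apply/(@cvgrPdist_lt _ _ _ (nbhs x) (nbhs_filter x)) => e e0; exact: h.
Qed.

(** The Hamiltonian after time reversal, which flips the time derivative alone; [negH] also flips
    the gradient. *)
Definition oppH H : V -> V -> R := fun x p => - H x p.

Definition subsolution H T u : Prop := forall z, strip_open T z ->
  forall a p, superdiff T u z a p -> a + H z.2 p <= 0.

Definition supersolution H T u : Prop := forall z, strip_open T z ->
  forall a p, subdiff T u z a p -> 0 <= a + H z.2 p.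

Lemma forward_solP H T u : forward_sol H T u <->
  [/\ {within strip_closed T, continuous u}, subsolution H T u & supersolution H T u].
Proof.
split=> [[cu h]|[cu h1 h2]]; first by split => // z /h [].
by split => // z Oz; split; [exact: h1|exact: h2].
Qed.

Lemma exists_region M T z : 0 <= M -> 0 <= z.1 < T ->
  exists2 delta, 0 < delta & region0 M delta T z.
Proof.
move=> M0 /andP[z0 zT]; set c := expR (4 * M * z.1) * (1 + dotv z.2 z.2).
have c0 : 0 < c by rewrite mulr_gt0 ?expR_gt0// ltr_pwDl ?dotv_ge0.
exists ((T - z.1) / (2 * c)); first by rewrite divr_gt0// ?subr_gt0// mulr_gt0.
split => //; rewrite /cone -/c.
have -> : (T - z.1) / (2 * c) * c = (T - z.1) / 2 by field; rewrite gt_eqF.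
lra.
Qed.

Lemma region0_lt M delta T z : 0 <= M -> 0 < delta ->
  region0 M delta T z -> 0 <= z.1 < T.
Proof.
move=> M0 d0 [z0 zT]; rewrite z0 /=; apply: le_lt_trans zT.
by rewrite /cone lerDl !mulr_ge0 ?(ltW d0) ?expR_ge0// addr_ge0// dotv_ge0.
Qed.

Lemma region_strip M delta T z : 0 <= M -> 0 < delta ->
  region M delta T z -> strip_open T z.
Proof.
move=> M0 d0 Dz; have /andP[_ zT] := region0_lt M0 d0 (region_sub0 Dz).
by case: Dz => z0 _; apply/andP.
Qed.

(** Every point before time [T] lies in a region with [delta] small; time [T] follows by continuity,
    stepping back along [(-1, 0)]. *)
Theorem comparison_strip M H T u v : Hlip M H ->
  {within strip_closed T, continuous u} -> {within strip_closed T, continuous v} ->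
  subsolution H T u -> supersolution H T v ->
  (forall x, u (0, x) <= v (0, x)) ->
  forall z, strip_closed T z -> u z <= v z.
Proof.
move=> HM cu cv su sv ini; have [M0 _ _] := HM.
have lt z : 0 <= z.1 < T -> u z <= v z.
  move=> zT; have [d d0 Dz] := exists_region M0 zT.
  have D0C : @region0 R n M d T `<=` strip_closed T.
    move=> y /(region0_lt M0 d0)/andP[? ?].
    by apply/andP; split => //; exact: ltW.
  have [uu _] := (within_uscP _ _).1 cu; have [_ uv] := (within_uscP _ _).1 cv.
  rewrite -subr_le0.
  apply: (comparison_region HM d0 (uscS D0C uu) (uscS D0C uv)) Dz.
  - by move=> y /(region_strip M0 d0) Oy a /(gsup_superdiff Oy); exact: su.
  - move=> y /(region_strip M0 d0) Oy a /(gsup_superdiff Oy) sa.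
    have : subdiff T v y (- a.1) (- a.2) by apply/subdiffP => //; rewrite !opprK.
    by move=> /(sv y Oy); rewrite /Fop /negH; lra.
  - by move=> x _; rewrite subr_le0.
move=> z /andP[z0 zT]; have [zT'|zT'] := ltP z.1 T; first by apply: lt; rewrite z0.
rewrite leNgt; apply/negP => vu; have Cz : strip_closed T z by apply/andP.
have eT : z.1 = T by apply/eqP; rewrite eq_le zT.
pose e := (u z - v z) / 2; have e0 : 0 < e by rewrite /e; lra.
have nu := (within_continuousP _ _).1 cu z Cz e e0.
have nv := (within_continuousP _ _).1 cv z Cz e e0.
have [s0 s00 Hs0] := near_line ((-1, 0) : E) (filterI nu nv).
have [T0|T0] := ltP 0 T; last first.
  have z00 : z.1 = 0 by lra.
  by have := ini z.2; rewrite -z00 -surjective_pairing; lra.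
pose s := Num.min s0 T / 2.
have m0 : 0 < Num.min s0 T by rewrite lt_min s00.
have sm : s < Num.min s0 T by rewrite /s; lra.
have sp : 0 < s by rewrite /s; lra.
move: sm; rewrite lt_min => /andP[ss0 sT].
have y1 : (z + s *: ((-1, 0) : E)).1 = T - s.
  by rewrite /= eT /GRing.scale /= mulrN1.
have yT : 0 <= (z + s *: ((-1, 0) : E)).1 < T by rewrite y1; apply/andP; lra.
have Cy : strip_closed T (z + s *: ((-1, 0) : E)).
  by move: yT => /andP[? ?]; apply/andP; split => //; exact: ltW.
have [/(_ Cy) a1 /(_ Cy) a2] := Hs0 s sp ss0.
have := lt _ yT; move: a1 a2; rewrite !ltr_norml /e; lra.
Qed.

(* The solutions on the regions of parameter [d] agree on overlaps; they are built
   up to time [T + 1] so that the strip, including [t = T], is covered. *)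
Theorem forward_sol_exists M H T (g : V -> R) : 0 <= T -> Hlip M H -> continuous g ->
  exists u, forward_sol H T u /\ forall x, u (0, x) = g x.
Proof.
move=> T0 HM cg; have [M0 _ _] := HM; pose T1 := T + 1.
have /choice[F HF] : forall d, exists f : E -> R, 0 < d ->
  [/\ usc (region0 M d T1) f, usc (region0 M d T1) (fun y => - f y),
     lsubsol H (region M d T1) f, lsubsol (negH H) (region M d T1) (fun y => - f y)
     & forall x, region0 M d T1 (0, x) -> f (0, x) = g x].
  move=> d; have [d0|d0] := ltP 0 d; last by exists (fun=> 0) => h; lra.
  by have [f Hf] := perron_solution T1 d0 HM cg; exists f.
have /choice[dz Hdz] : forall z : E, exists d, 0 < d /\ (0 <= z.1 < T1 -> region0 M d T1 z).
  move=> z; have [zT|zT] := boolP (0 <= z.1 < T1); last by exists 1.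
  by have [d d0 Dz] := exists_region M0 zT; exists d.
pose u z := F (dz z) z.
have regS d d' : 0 < d -> d <= d' -> @region0 R n M d' T1 `<=` region0 M d T1.
  move=> d0 dd' y [y0 yT]; split => //; apply: le_lt_trans yT.
  rewrite /cone lerD2l ler_wpM2r// mulr_ge0 ?expR_ge0//.
  by rewrite addr_ge0 ?dotv_ge0.
have regS' d d' : 0 < d -> d <= d' -> @region R n M d' T1 `<=` region M d T1.
  move=> d0 dd' y Dy; have [_ yT] := regS d d' d0 dd' y (region_sub0 Dy).
  by case: Dy.
(* On the smaller region, that of [d'], both functions are solutions with data [g]. *)
have Fle d d' : 0 < d -> d <= d' -> forall z, region0 M d' T1 z -> F d z = F d' z.
  move=> d0 dd' z Dz; have d'0 := lt_le_trans d0 dd'.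
  have [u1 v1 su1 sv1 i1] := HF d d0; have [u2 v2 su2 sv2 i2] := HF d' d'0.
  have S0 := regS d d' d0 dd'; have S := regS' d d' d0 dd'.
  apply/eqP; rewrite eq_le -subr_le0 -(subr_le0 (F d z)).
  apply/andP; split.
    apply: (comparison_region HM d'0 (uscS S0 u1) v2 _ (lsubsol_gsubsol sv2)) Dz.
      by apply: lsubsol_gsubsol => y /S; exact: su1.
    by move=> x Dx; rewrite i1 ?i2 ?subrr//; exact: S0.
  apply: (comparison_region HM d'0 u2 (uscS S0 v1) (lsubsol_gsubsol su2)) Dz.
    by apply: lsubsol_gsubsol => y /S; exact: sv1.
  by move=> x Dx; rewrite i1 ?i2 ?subrr//; exact: S0.
have uF d z : 0 < d -> region0 M d T1 z -> u z = F d z.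
  move=> d0 Dz; have [dz0 Hz] := Hdz z.
  have Dz' := Hz (region0_lt M0 d0 Dz).
  rewrite /u; have [dd|dd] := leP d (dz z); last by apply: Fle => //; exact: ltW.
  by apply/esym; exact: Fle.
have closed_T1 z : strip_closed T z -> 0 <= z.1 < T1.
  by move=> /andP[? ?]; apply/andP; split => //; rewrite /T1; lra.
have near_cone d z : region0 M d T1 z -> \forall y \near z, cone M d y < T1.
  by move=> [_ zT]; exact: (cvgr_lt _ (@cone_continuous _ _ M d z)).
exists u; split; last first.
  move=> x; have [d0 Hz] := Hdz (0, x).
  have Dx : region0 M (dz (0, x)) T1 ((0, x) : E).
    by apply: Hz; rewrite lexx /= ltr_wpDl.
  by have [_ _ _ _ ini] := HF _ d0; exact: ini.
apply/forward_solP; split.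
- apply/within_uscP; split => z Cz c uc; have [d0 Hz] := Hdz z;
    have Dz := Hz (closed_T1 z Cz); have [u1 v1 _ _ _] := HF _ d0.
    apply: filterS2 (near_cone _ _ Dz) (u1 z Dz c uc) => y yT + /andP[y0 _].
    have Dy : region0 M (dz z) T1 y by split.
    by rewrite (uF _ _ d0 Dy); exact.
  apply: filterS2 (near_cone _ _ Dz) (v1 z Dz c uc) => y yT + /andP[y0 _].
  have Dy : region0 M (dz z) T1 y by split.
  by rewrite (uF _ _ d0 Dy); exact.
- move=> z Oz a p /(superdiff_lsup Oz) la; have [d0 Hz] := Hdz z.
  have Dz0 := Hz (closed_T1 z (strip_open_closed Oz)).
  have Dz : region M (dz z) T1 z by case: Dz0 => _ ?; case/andP: Oz.
  have [_ _ su _ _] := HF _ d0.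
  apply: (su z Dz (a, p)); apply: lsup_le la => //.
  by apply: filterS (near_region Dz) => y Dy; rewrite (uF _ _ d0 (region_sub0 Dy)).
- move=> z Oz a p /(subdiffP _ _ _ Oz) /(superdiff_lsup Oz) la; have [d0 Hz] := Hdz z.
  have Dz0 := Hz (closed_T1 z (strip_open_closed Oz)).
  have Dz : region M (dz z) T1 z by case: Dz0 => _ ?; case/andP: Oz.
  have [_ _ _ sv _] := HF _ d0.
  have : lsup (fun y => - F (dz z) y) z (- a, - p).
    apply: lsup_le la => //.
    by apply: filterS (near_region Dz) => y Dy; rewrite (uF _ _ d0 (region_sub0 Dy)).
  by move=> /(sv z Dz); rewrite /Fop /negH /= opprK; lra.
Qed.

(** * Time reversal and the Barron-Jensen equivalence on the strip *)

Lemma Hlip_opp M H : Hlip M H -> Hlip M (oppH H).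
Proof.
by move=> [M0 h1 h2]; split => // x p q; rewrite /oppH -opprD normrN.
Qed.

Definition convex_in_p H : Prop := forall (x p q : V) (l : R), 0 <= l <= 1 ->
  H x (l *: p + (1 - l) *: q) <= l * H x p + (1 - l) * H x q.

Lemma superdiff_revK T u z (b : R) (p : V) : strip_open T z ->
  superdiff T (u \o trev T) z b p -> superdiff T u (trev T z) (- b) p.
Proof.
move=> Oz /(superdiff_rev Oz); congr (superdiff _ _ _ _ _).
by apply/funext => y; rewrite /= trevK.
Qed.

Lemma subdiff_revK T u z (b : R) (p : V) : strip_open T z ->
  subdiff T (u \o trev T) z b p -> subdiff T u (trev T z) (- b) p.
Proof.
move=> Oz /(subdiff_rev Oz); congr (subdiff _ _ _ _ _).
by apply/funext => y; rewrite /= trevK.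
Qed.

Lemma backward_rev H T w : backward_sol H T w -> forward_sol (oppH H) T (w \o trev T).
Proof.
move=> [cw hw]; apply/forward_solP; split; first exact: within_strip_rev.
  move=> z Oz a p /(superdiff_revK Oz) s.
  by have := (hw _ (strip_open_rev Oz)).1 _ _ s; rewrite /oppH /=; lra.
move=> z Oz a p /(subdiff_revK Oz) s.
by have := (hw _ (strip_open_rev Oz)).2 _ _ s; rewrite /oppH /=; lra.
Qed.

Lemma forward_rev H T w : forward_sol (oppH H) T w -> backward_sol H T (w \o trev T).
Proof.
move=> [cw hw]; split; first exact: within_strip_rev.
move=> z Oz; split=> a p.
  move=> /(superdiff_revK Oz) s.
  by have := (hw _ (strip_open_rev Oz)).1 _ _ s; rewrite /oppH /=; lra.
move=> /(subdiff_revK Oz) s.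
by have := (hw _ (strip_open_rev Oz)).2 _ _ s; rewrite /oppH /=; lra.
Qed.

Definition lower_subsolution H T u : Prop := forall z, strip_open T z ->
  forall a p, subdiff T u z a p -> a + H z.2 p <= 0.

Lemma lower_subsolution_sub M H T u : Hlip M H -> convex_in_p H ->
  {within strip_closed T, continuous u} ->
  lower_subsolution H T u -> subsolution H T u.
Proof.
move=> HM Hc cu lu z Oz a p /(superdiff_lsup Oz).
apply: (barron_jensen HM Hc (@open_strip _ _ T)) Oz (a, p) => [y Oy|y b Oy].
  exact: within_strip_for cu Oy.
move=> /(gsup_superdiff Oy) /(subdiffP u b.1 b.2 Oy); exact: lu.
Qed.

(** Replacing [u] by [- (u \o trev T)] exchanges super- and subdifferentials, keeps the time
    derivative and flips the spatial gradient. The converse is thus [lower_subsolution_sub] for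
    [H x (- p)], which is again convex in [p]. *)
Lemma subsolution_lower M H T u : Hlip M H -> convex_in_p H ->
  {within strip_closed T, continuous u} ->
  subsolution H T u -> lower_subsolution H T u.
Proof.
move=> HM Hc cu su z Oz a p sa.
pose H' : V -> V -> R := fun x p => H x (- p).
have HM' : Hlip M H'.
  have [M0 h1 h2] := HM; split => // x y q; rewrite /H'.
    by apply: le_trans (h1 _ _ _) _; rewrite -opprD enormN.
  by apply: le_trans (h2 _ _ _) _; rewrite enormN.
have Hc' : convex_in_p H'.
  move=> x q q' l l01; rewrite /H' opprD -!scalerN; exact: Hc.
pose v := fun y => - (u \o trev T) y.
have cv : {within strip_closed T, continuous v}.
  have [u1 u2] := (within_uscP _ _).1 (within_strip_rev cu).
  apply/within_uscP; split; first exact: u2.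
  have -> : (fun y => - v y) = u \o trev T by apply/funext => y; rewrite /v opprK.
  exact: u1.
have lv : lower_subsolution H' T v.
  move=> y Oy b q /(subdiffP _ _ _ Oy).
  have -> : (fun y => - v y) = u \o trev T by apply/funext => ?; rewrite /v opprK.
  move=> /(superdiff_revK Oy); rewrite opprK => s.
  exact: su _ (strip_open_rev Oy) _ _ s.
have Or := strip_open_rev Oz.
have : superdiff T v (trev T z) (- - a) (- p).
  by apply/subdiffP => //; exact: subdiff_rev.
move=> /(lower_subsolution_sub HM' Hc' cv lv Or).
by rewrite /H' !opprK.
Qed.

End Strip.

(** * Ordering and reconstructibility *)

Theorem theorem1p7 (R : realType) (n : nat) (T : R) (H : vec R n -> vec R n -> R)
  (hT : 0 < T)
  (Hconv : forall (x p q : vec R n) (l : R), 0 <= l <= 1 ->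
     H x (l *: p + (1 - l) *: q) <= l * H x p + (1 - l) * H x q)
  (M : R) (hM : 0 <= M)
  (Hlip_p : forall x p q : vec R n,
     `|H x p - H x q| <= M * (1 + enorm x) * enorm (p - q))
  (Hlip_x : forall x y p : vec R n,
     `|H x p - H y p| <= M * (1 + enorm p) * enorm (x - y))
  (g0 : vec R n -> R) (hg0 : continuous g0) :
  (reconstructible H T g0 <->
     exists v, backward_sol H T v /\ forall x, v (0, x) = g0 x) /\
  (forall v u w : spt R n -> R,
     backward_sol H T v -> (forall x, v (0, x) = g0 x) ->
     forward_sol H T u -> (forall x, u (0, x) = g0 x) ->
     backward_sol H T w -> (forall x, w (T, x) = u (T, x)) ->
     forall z, strip_closed T z -> v z <= w z /\ w z <= u z).
Proof.
have HM : Hlip M H by split.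
have HMo := Hlip_opp HM.
have ordering : forall v u w : spt R n -> R,
     backward_sol H T v -> (forall x, v (0, x) = g0 x) ->
     forward_sol H T u -> (forall x, u (0, x) = g0 x) ->
     backward_sol H T w -> (forall x, w (T, x) = u (T, x)) ->
     forall z, strip_closed T z -> v z <= w z /\ w z <= u z.
  move=> v u w bv v0 fu u0 bw wT.
  have /forward_solP[cu su Su] := fu.
  have cv : {within strip_closed T, continuous v} := bv.1.
  have vu : forall z, strip_closed T z -> v z <= u z.
    apply: (comparison_strip HM cv cu) => //; last by move=> x; rewrite v0 u0.
    apply: (lower_subsolution_sub HM) => // z Oz a p.
    exact: (bv.2 z Oz).2.
  have /forward_solP[cvr svr Svr] := backward_rev bv.
  have /forward_solP[cwr swr Swr] := backward_rev bw.
  have lu := subsolution_lower HM Hconv cu su.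
  have rev0 (f : spt R n -> R) x : (f \o trev T) (0, x) = f (T, x).
    by rewrite /= /trev /= subr0.
  have vw := comparison_strip HMo cvr cwr svr Swr.
  have wu := comparison_strip HMo cwr (within_strip_rev cu) swr.
  move=> z Cz; rewrite -(trevK T z); have Cr := strip_closed_rev Cz; split.
    apply: vw Cr => x; rewrite !rev0 wT; apply: vu.
    by apply/andP; split => //=; exact: ltW.
  apply: wu Cr => [y Oy a p|x]; last by rewrite !rev0 wT.
  move=> /(subdiff_revK Oy) /(lu _ (strip_open_rev Oy)).
  by rewrite /oppH /=; lra.
have C0 (x : vec R n) : strip_closed T ((0, x) : spt R n).
  by apply/andP; split => //=; exact: ltW.
(* In the direct implication the reconstructed [w] itself serves as [v]. *)
split=> //; split => [[u [w [_ [[[bw wT] _] w0]]]]|[v [bv v0]]]; first by exists w.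
have [u [fu u0]] := forward_sol_exists (ltW hT) HM hg0.
have /forward_solP[cu su Su] := fu.
have cuT : continuous (fun x => u (T, x)).
  by apply: (continuous_slice cu); rewrite lexx ltW.
(* A forward solution for [oppH H] started from [u (T, x)] becomes, read backwards in time, the
   required backward solution. *)
have [W [fW W0]] := forward_sol_exists (ltW hT) HMo cuT.
have bw := forward_rev fW.
have wT x : (W \o trev T) (T, x) = u (T, x) by rewrite /= /trev /= subrr W0.
exists u, (W \o trev T); split; [split => //|split; [split => //|]].
- move=> u' [/forward_solP[cu' su' Su'] u0'] z Cz; apply/eqP; rewrite eq_le.
  apply/andP; split.
    by apply: (comparison_strip HM cu' cu su' Su) Cz => x; rewrite u0 u0'.
  by apply: (comparison_strip HM cu cu' su Su') Cz => x; rewrite u0 u0'.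
- have /forward_solP[cW sW SW] := fW.
  move=> w' [bw' wT'] z Cz; have /forward_solP[cW' sW' SW'] := backward_rev bw'.
  have e0 x : (w' \o trev T) (0, x) = W (0, x) by rewrite W0 /= /trev /= subr0 wT'.
  have Cr := strip_closed_rev Cz.
  rewrite -{1}(trevK T z) -[w' _]/((w' \o trev T) (trev T z)) /=.
  apply/eqP; rewrite eq_le; apply/andP; split.
    by apply: (comparison_strip HMo cW' cW sW' SW) Cr => x; rewrite e0.
  by apply: (comparison_strip HMo cW cW' sW SW') Cr => x; rewrite e0.
- move=> x; have [vw wu] := ordering v u _ bv v0 fu u0 bw wT _ (C0 x).
  by apply/eqP; rewrite eq_le -{1}(u0 x) wu -(v0 x) vw.
Qed.
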